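(* Let $f$ be a positive operator monotone function defined in the positive half-line $(0,\infty)$. There is a bounded positive measure $\mu$ on the closed interval $[0,1]$ such that \[ f(t)=\int_0^1\frac{t}{\lambda+(1-\lambda)t}\,d\mu(\lambda)\qquad t>0. \] Conversely, any function given in this form (with $\mu$ a bounded positive measure on $[0,1]$) is operator monotone. The measure $\mu$ is a probability measure if and only if $f(1)=1$.
   Context: For a function $f\colon I\to\mathbf R$ on an interval $I$ and a hermitian matrix $x$ with spectrum in $I$, $f(x)$ is defined by the functional calculus (spectral theorem). The function $f$ is $n$-monotone if $x\le y$ implies $f(x)\le f(y)$ for every pair of $n\times n$ hermitian matrices $x,y$ with spectra in $I$, where $\le$ is the order given by positive semi-definiteness of the difference. It is operator monotone if it is $n$-monotone for all natural numbers $n$. A positive function takes values in $(0,\infty)$. Measures are Borel measures, and integrals over $[0,1]$ include possible atoms at the end points. *)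

(* Defs.v *)
From mathcomp Require Import all_boot all_order all_algebra.
From mathcomp Require Import all_classical all_reals all_analysis.
From mathcomp Require Import complex.
Set Implicit Arguments.
Unset Strict Implicit.
Unset Printing Implicit Defensive.
Import Order.TTheory GRing.Theory Num.Theory.
Import numFieldNormedType.Exports.
Local Open Scope classical_set_scope.
Local Open Scope ring_scope.
Local Open Scope complex_scope.
Local Open Scope sesquilinear_scope.

Section Matrices.
Context {R : realType}.

Definition spectrum_in (I : interval R) n (x : 'M[R[i]]_n) : Prop :=
  forall a : R[i], eigenvalue x a -> exists2 r : R, r \in I & a = r%:C.

(* [0 <= z] in [R[i]] means that z is real and nonnegative. *)
Definition psdmx n (x : 'M[R[i]]_n) : Prop :=
  x \is hermsymmx /\ forall v : 'cV[R[i]]_n, 0 <= (v^t* *m x *m v) 0 0.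

Definition loewner_le n (x y : 'M[R[i]]_n) : Prop := psdmx (y - x).

(* For x hermitian, [spectralmx x] is unitary, the entries of
   [spectral_diag x] are real, and
   [x = invmx (spectralmx x) *m diag_mx (spectral_diag x) *m spectralmx x]
   (see [orthomx_spectralP]).  The function f is only evaluated at the
   eigenvalues of x. *)
Definition funcalc (f : R -> R) n (x : 'M[R[i]]_n) : 'M[R[i]]_n :=
  invmx (spectralmx x)
    *m diag_mx (map_mx (fun z : R[i] => (f (complex.Re z))%:C)
                       (spectral_diag x))
    *m spectralmx x.

(* A function on I is a total function whose values off I are irrelevant. *)
Definition n_monotone (I : interval R) (f : R -> R) (n : nat) : Prop :=
  forall x y : 'M[R[i]]_n,
    x \is hermsymmx -> y \is hermsymmx ->
    spectrum_in I x -> spectrum_in I y ->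
    loewner_le x y -> loewner_le (funcalc f x) (funcalc f y).

Definition operator_monotone (I : interval R) (f : R -> R) : Prop :=
  forall n : nat, n_monotone I f n.

End Matrices.

Section Representation.
Context {R : realType}.

(* Borel measures on [0, 1] are encoded as the Borel measures on the line
   that do not charge the complement of [0, 1]. *)
Definition on_unit_interval
    (mu : {measure set (measurableTypeR R) -> \bar R}) : Prop :=
  mu (~` `[0, 1]) = 0%E.

Definition represents
    (mu : {measure set (measurableTypeR R) -> \bar R}) (f : R -> R) : Prop :=
  forall t : R, 0 < t ->
    (f t)%:E = (\int[mu]_(l in `[0%R, 1%R]) (t / (l + (1 - l) * t))%:E)%E.

End Representation.

(* Main.v *)
(* Let [f] be positive and operator monotone.  Applying monotonicity
   to [diag t] and to its rank-one perturbation with prescribed interlacing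
   eigenvalues shows that the divided difference of [p^2 f] at any [2n] distinct
   positive points is nonnegative for real polynomials [p] of degree less
   than [n].  Sending one node to [0] or to infinity gives the sign of the
   divided differences of [t^j phi], where [phi t = f t / t], at any number [N]
   of nodes and for all [j < N].  The class of functions [phi] with these signs is
   stable under [phi |-> (t phi t - phi 1) / (t - 1)] and
   [phi |-> (phi 1 - phi t) / (t - 1)], which on
   [phi t = \int 1 / (l + (1 - l) t) dmu(l)] multiply [mu] by [l] and by [1 - l].
   Iterating both maps and evaluating at [1] produces nonnegative numbers
   [\int l^n (1 - l)^k dmu(l)], that is, a Hausdorff moment sequence; its measure
   represents [phi] by expanding in powers of [(t - 1) / t] if [t >= 1] and of
   [1 - t] if [t < 1].  Conversely, for each [l] the quadratic form of
   [t / (l + (1 - l) t)] at [x] is the minimum of [l <u, x u> + (1 - l) <z, z>] over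
   [l u + (1 - l) z = v], hence increasing in [x]. *)

Require Import Defs.
From HB Require Import structures.
From mathcomp Require Import all_boot all_order all_algebra.
From mathcomp Require Import all_classical all_reals all_analysis.
From mathcomp Require Import complex measurable_realfun.
From mathcomp Require Import ring lra zify.
Set Implicit Arguments.
Unset Strict Implicit.
Unset Printing Implicit Defensive.
Import Order.TTheory GRing.Theory Num.Theory.
Import numFieldNormedType.Exports.
Local Open Scope classical_set_scope.
Local Open Scope ring_scope.

(** * Divided differences *)

Section DividedDifferences.
Context {R : fieldType}.
Implicit Types (s : seq R) (g : R -> R) (p : {poly R}).

(** Lagrange form of the divided difference of [g] at the nodes [s], of order [size s - 1] when [s]
    has no repetition. *)
Definition dd s g : R := \sum_(x <- s) g x / \prod_(y <- s | y != x) (x - y).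

Lemma dd_perm s1 s2 g : perm_eq s1 s2 -> dd s1 g = dd s2 g.
Proof.
move=> s12; rewrite /dd (perm_big _ s12).
by apply: eq_bigr => x _; rewrite (perm_big _ s12).
Qed.

Lemma eq_dd s g h : {in s, g =1 h} -> dd s g = dd s h.
Proof. by move=> gh; rewrite /dd !big_seq; apply: eq_bigr => x /gh ->. Qed.

Lemma ddD s g h : dd s (fun x => g x + h x) = dd s g + dd s h.
Proof. by rewrite /dd -big_split; apply: eq_bigr => x _; rewrite mulrDl. Qed.

Lemma ddZ s a g : dd s (fun x => a * g x) = a * dd s g.
Proof. by rewrite /dd mulr_sumr; apply: eq_bigr => x _; rewrite mulrA. Qed.

Lemma ddN s g : dd s (fun x => - g x) = - dd s g.
Proof. by rewrite -mulN1r -ddZ; apply: eq_dd => x _; rewrite mulN1r. Qed.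

Lemma prod_other_notin s x : x \notin s ->
  \prod_(y <- s | y != x) (x - y) = \prod_(y <- s) (x - y).
Proof.
move=> xs; rewrite [RHS]big_seq [LHS]big_seq_cond.
by apply: eq_bigl => y; case: (boolP (y \in s)) => //= ys; apply: contraNneq xs
  => <-.
Qed.

Lemma dd_cons a s g : a \notin s ->
  dd (a :: s) g = g a / \prod_(y <- s) (a - y)
    + \sum_(x <- s) g x / ((x - a) * \prod_(y <- s | y != x) (x - y)).
Proof.
move=> aNs; rewrite /dd big_cons big_cons eqxx /= prod_other_notin //; congr (_
  + _).
rewrite !big_seq; apply: eq_bigr => x xs; rewrite big_cons.
by case: eqVneq => [ax|//]; rewrite ax xs in aNs.
Qed.

Lemma dd_cat s1 s2 g : uniq (s1 ++ s2) ->
  dd (s1 ++ s2) g =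
    \sum_(x <- s1) g x /
       (\prod_(y <- s1 | y != x) (x - y) * \prod_(y <- s2) (x - y))
  + \sum_(x <- s2) g x /
       (\prod_(y <- s1) (x - y) * \prod_(y <- s2 | y != x) (x - y)).
Proof.
rewrite cat_uniq => /and3P[_ /hasPn s12 _].
rewrite /dd big_cat; congr (_ + _); rewrite !big_seq; apply: eq_bigr => x xs;
  rewrite big_cat /=.
- by rewrite (@prod_other_notin s2) //; apply: contraL xs => /s12.
- by rewrite (@prod_other_notin s1) //; exact: s12.
Qed.

(** The term of [a] vanishes and [x - a] cancels in every other denominator: a factor vanishing at a
    node removes that node. *)
Lemma dd_factor a s g : uniq (a :: s) ->
  dd (a :: s) (fun x => (x - a) * g x) = dd s g.
Proof.
move=> /andP[aNs _]; rewrite dd_cons // subrr mul0r mul0r add0r /dd !big_seq.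
apply: eq_bigr => x xs; rewrite -mulf_div divff ?mul1r // subr_eq0.
by apply: contraNneq aNs => <-.
Qed.

(** Writing [b - c = (x - c) - (x - b)], [dd_factor] expresses [b - c] times the divided difference
    at [b :: c :: s] as the difference of those at [b :: s] and [c :: s]. These vanish by induction,
    or cancel when [s] is empty. *)
Lemma dd_const s a : uniq s -> (1 < size s)%N -> dd s (fun=> a) = 0.
Proof.
have [n] := ubnP (size s); elim: n s => // n IH [//|b [//|c s]] /= sz us _.
have [bc us'] : b - c != 0 /\ uniq (b :: c :: s).
  by split=> //; move: us; rewrite inE negb_or subr_eq0 => /andP[/andP[]].
have swap : perm_eq (b :: c :: s) (c :: b :: s) := permEl (perm_catCA [:: b] [::
  c] s).
have uc : uniq (c :: b :: s) by rewrite -(perm_uniq swap).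
have Ec : dd (b :: c :: s) (fun x => (x - c) * a) = dd (b :: s) (fun=> a).
  by rewrite (dd_perm _ swap) dd_factor.
have Eb := dd_factor (fun=> a) us'.
have /eqP : (b - c) * dd (b :: c :: s) (fun=> a) = dd (b :: s) (fun=> a)
  - dd (c :: s) (fun=> a).
  by rewrite -Ec -Eb -ddN -ddD -ddZ; apply: eq_dd => x _; ring.
have -> : dd (b :: s) (fun=> a) - dd (c :: s) (fun=> a) = 0.
  have [/size0nil s0|s0] := posnP (size s).
    by rewrite s0 /dd !big_cons !big_nil !eqxx subrr.
  move: us' uc => /andP[_ u1] /andP[_ u2].
  by rewrite !IH ?subrr // ltnS.
by rewrite mulf_eq0 (negPf bc) => /eqP.
Qed.

(** Division of [p - p.[a]%:P] by ['X - a%:P] lowers the degree and, through [dd_factor], the number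
    of nodes by one. *)
Lemma dd_poly s p : uniq s -> (size p < size s)%N -> dd s (horner p) = 0.
Proof.
elim: s p => // a s IH p us; rewrite /= ltnS => ps.
have /factor_theorem[q Eq] : root (p - p.[a]%:P) a by rewrite /root !hornerE subrr.
have Ep x : p.[x] = p.[a] + (x - a) * q.[x].
  by have /(congr1 (horner^~ x)) := Eq; rewrite !hornerE mulrC => <-; ring.
have [s0|s0] := posnP (size s).
  have p0 : p = 0 by apply/eqP; rewrite -size_poly_eq0 -leqn0 -s0.
  by rewrite p0 /dd big1 // => x _; rewrite horner0 mul0r.
have q0 : (size q < size s)%N.
  have [->|qn0] := eqVneq q 0; first by rewrite size_poly0.
  have : size (p - p.[a]%:P) = (size q).+1.
    by rewrite Eq size_Mmonic ?monicXsubC ?size_XsubC ?addn2.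
  move=> E; rewrite -E (leq_trans (size_polyD _ _)) // geq_max ps size_polyN.
  by rewrite (leq_trans (size_polyC_leq1 _)).
rewrite (eq_dd (h := fun x => p.[a] + (x - a) * q.[x])) => [|x _]; last exact: Ep.
rewrite ddD dd_const // add0r dd_factor // IH //.
by case/andP: us.
Qed.

(** [dd_poly] at the nodes [a :: s], solved for the term of [a]; this is Lagrange interpolation at
    [s], evaluated at [a]. *)
Lemma partial_fraction s a p : uniq (a :: s) -> (size p <= size s)%N ->
  \sum_(x <- s) p.[x] / ((a - x) * \prod_(y <- s | y != x) (x - y))
    = p.[a] / \prod_(y <- s) (a - y).
Proof.
move=> us ps; have := dd_poly us (ps : (size p < size (a :: s))%N).
move: us => /andP[aNs _]; rewrite dd_cons // => /eqP; rewrite addr_eq0 => /eqP ->.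
by rewrite -sumrN; apply: eq_bigr => x _; rewrite -opprB mulNr invrN mulrN.
Qed.

Lemma size_monic_sub (p q : {poly R}) n :
  p \is monic -> q \is monic -> size p = n.+1 -> size q = n.+1 ->
  (size (p - q)%R <= n)%N.
Proof.
move=> /monicP p1 /monicP q1 sp sq; apply/leq_sizeP => j; rewrite leq_eqVlt coefB.
case/orP => [/eqP <-|nj]; last by rewrite !nth_default ?subr0 // ?sp ?sq.
by move: p1 q1; rewrite /lead_coef sp sq /= => -> ->; rewrite subrr.
Qed.

(* Partial fractions of [Q / P] with [P], [Q] monic of the same degree:
   [Q a / P a = 1 + sum_x (Q x / P' x) / (a - x)], evaluated at a root of [Q]. *)
Lemma secular_equation s1 s2 a : uniq (a :: s1) -> size s1 = size s2 -> a \in s2 ->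
  \sum_(x <- s1)
    - (\prod_(y <- s2) (x - y) / \prod_(y <- s1 | y != x) (x - y)) / (a - x) = 1.
Proof.
move=> us s12 as2.
pose P : {poly R} := \prod_(y <- s1) ('X - y%:P).
pose Q : {poly R} := \prod_(y <- s2) ('X - y%:P).
have hP x : P.[x] = \prod_(y <- s1) (x - y).
  by rewrite horner_prod; apply: eq_bigr => y _; rewrite hornerXsubC.
have hQ x : Q.[x] = \prod_(y <- s2) (x - y).
  by rewrite horner_prod; apply: eq_bigr => y _; rewrite hornerXsubC.
have sPQ : (size (P - Q)%R <= size s1)%N.
  by apply: size_monic_sub; rewrite ?monic_prod_XsubC ?size_prod_XsubC ?s12.
have := partial_fraction us sPQ.
have Qa : Q.[a] = 0 by rewrite hQ (big_rem a) //= subrr mul0r.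
rewrite hornerD hornerN Qa subr0 hP divff; last first.
  rewrite prodf_seq_neq0; apply/allP => y ys1 /=; rewrite subr_eq0.
  by case/andP: us => aNs _; apply: contraNneq aNs => ->.
apply: etrans; rewrite !big_seq; apply: eq_bigr => x xs1.
have Px : P.[x] = 0 by rewrite hP (big_rem x) //= subrr mul0r.
by rewrite hornerD hornerN Px sub0r hQ mulNr mulNr -mulrA -invfM (mulrC (a - x)).
Qed.

Lemma partial_fractionN s2 p x : uniq (x :: s2) -> (size p <= size s2)%N ->
  \sum_(a <- s2) p.[a] / (\prod_(y <- s2 | y != a) (a - y) * (a - x))
    = - (p.[x] / \prod_(y <- s2) (x - y)).
Proof.
move=> us sp; rewrite -partial_fraction // -sumrN; apply: eq_bigr => a _.
by rewrite (mulrC (x - a)) -(opprB x a) mulrN invrN mulrN.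
Qed.
End DividedDifferences.

(** * Functional calculus *)

Section FunctionalCalculus.
Local Open Scope complex_scope.
Local Open Scope sesquilinear_scope.
Context {R : realType}.
Implicit Types (f : R -> R) (n : nat).

Lemma conj_real (a : R) : Num.conj (a%:C) = a%:C.
Proof. by apply/CrealP; rewrite complex_real. Qed.

Lemma hermsymmxP n (x : 'M[R[i]]_n) : reflect (x^t* = x) (x \is hermsymmx).
Proof.
by apply: (iffP (is_hermitianmxP _ _ x)); rewrite expr0 scale1r => /esym.
Qed.

Definition spectral_val n (x : 'M[R[i]]_n) (i : 'I_n) : R :=
  complex.Re (spectral_diag x 0 i).

Definition real_diag n (r : 'I_n -> R) : 'M[R[i]]_n :=
  diag_mx (\row_i (r i)%:C).

Lemma real_diag_adj n (r : 'I_n -> R) : (real_diag r)^t* = real_diag r.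
Proof.
by rewrite tr_diag_mx map_diag_mx; congr diag_mx; apply/rowP => i; rewrite !mxE;
  exact: conj_real.
Qed.

Lemma funcalcE f n (x : 'M[R[i]]_n) :
  funcalc f x =
    (spectralmx x)^t* *m real_diag (f \o spectral_val x) *m spectralmx x.
Proof.
rewrite /funcalc invmx_unitary ?spectral_unitarymx //; congr (_ *m diag_mx _ *m _).
by apply/rowP => i; rewrite !mxE.
Qed.

Lemma funcalc_id n (x : 'M[R[i]]_n) : x \is hermsymmx -> funcalc idfun x = x.
Proof.
move=> hx; rewrite /funcalc [RHS](orthomx_spectralP (hermitian_normalmx hx)).
congr (_ *m diag_mx _ *m _); apply/rowP => i; rewrite !mxE.
by rewrite RRe_real //; apply/mxOverP/hermitian_spectral_diag_real.
Qed.

Lemma funcalc_herm f n (x : 'M[R[i]]_n) : funcalc f x \is hermsymmx.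
Proof.
apply/hermsymmxP; rewrite funcalcE !trmx_mul !map_mxM real_diag_adj.
by rewrite -[in RHS](trmxCK (spectralmx x)) -mulmxA trmxCK.
Qed.

Lemma quad_sum n (P : 'M[R[i]]_n) (r : 'I_n -> R) (v : 'cV[R[i]]_n) :
  (v^t* *m (P^t* *m real_diag r *m P) *m v) 0 0
    = \sum_i (r i)%:C * `|(P *m v) i 0| ^+ 2.
Proof.
rewrite -!mulmxA mulmxA mul_diag_mx -map_mxM -trmx_mul mxE.
set w := P *m v; apply: eq_bigr => i _; rewrite !mxE normCK mulrCA.
by congr (_ * _); rewrite mulrC.
Qed.

Lemma spectral_val_in (I : interval R) n (x : 'M[R[i]]_n) :
  x \is hermsymmx -> spectrum_in I x -> forall i, spectral_val x i \in I.
Proof.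
move=> hx sx i; set P := spectralmx x.
have Pu : P \in unitmx by exact: spectral_unit.
have /sx[r rI] : eigenvalue x (spectral_diag x 0 i); last first.
  by rewrite /spectral_val => ->.
have xP : P *m x = diag_mx (spectral_diag x) *m P.
  by rewrite [in LHS](orthomx_spectralP (hermitian_normalmx hx)) !mulmxA mulmxV
    ?mul1mx.
apply/eigenvalueP; exists (row i P).
  by rewrite -row_mul xP; apply/rowP => j; rewrite mul_diag_mx !mxE.
apply/eqP => P0; move: Pu; rewrite -row_free_unit => /row_freeP[Q PQ].
have /rowP/(_ i) : row i (P *m Q) = 0 by rewrite row_mul P0 mul0mx.
by rewrite PQ !mxE eqxx => /eqP; rewrite oner_eq0.
Qed.

(** In the eigenbasis, each nonzero coordinate of [u] belongs to a spectral value equal to [a]. The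
    calculus can thus be evaluated on any eigenvector, whatever diagonalization [spectralmx]
    selects. *)
Lemma funcalc_eigen f n (x : 'M[R[i]]_n) (u : 'cV[R[i]]_n) (a : R) :
  x \is hermsymmx -> x *m u = a%:C *: u -> funcalc f x *m u = (f a)%:C *: u.
Proof.
move=> hx; rewrite -{1}(funcalc_id hx) !funcalcE; set P := spectralmx x => xu.
have PP : P *m P^t* = 1%:M by exact/unitarymxP/spectral_unitarymx.
have PP' : P^t* *m P = 1%:M by rewrite mulmx1C.
have DPu : real_diag (spectral_val x) *m (P *m u) = a%:C *: (P *m u).
  rewrite scalemxAr -xu !mulmxA PP mul1mx //.
rewrite -!mulmxA; suff -> : real_diag (f \o spectral_val x) *m (P *m u)
  = (f a)%:C *: (P *m u).
  by rewrite -scalemxAr mulmxA PP' mul1mx.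
apply/colP => i; have /colP/(_ i) := DPu; rewrite !mul_diag_mx !mxE /=.
have [->|c0] := eqVneq (\sum_j P i j * u j 0) 0; first by rewrite !mulr0.
by move/(mulIf c0)/complexI => ->.
Qed.

End FunctionalCalculus.

(** * Matrix monotonicity and divided differences *)

Section MonotoneDividedDifference.
Local Open Scope complex_scope.
Local Open Scope sesquilinear_scope.
Context {R : realType}.
Implicit Types (f : R -> R) (n : nat).

Definition real_col n (w : 'I_n -> R) : 'cV[R[i]]_n := \col_i (w i)%:C.

Lemma real_col_adj n (w : 'I_n -> R) : (real_col w)^t* = (real_col w)^T.
Proof. by apply/rowP => i; rewrite !mxE; exact: conj_real. Qed.

Lemma real_col_dot n (w u : 'I_n -> R) :
  ((real_col w)^T *m real_col u) 0 0 = (\sum_i w i * u i)%:C.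
Proof. by rewrite mxE rmorph_sum; apply: eq_bigr => i _; rewrite !mxE rmorphM. Qed.

Lemma real_diag_quad n (r w : 'I_n -> R) :
  ((real_col w)^T *m real_diag r *m real_col w) 0 0 = (\sum_i r i * w i ^+ 2)%:C.
Proof.
rewrite mul_mx_diag mxE rmorph_sum; apply: eq_bigr => i _.
by rewrite !mxE -!rmorphM /=; congr (_%:C); ring.
Qed.

Lemma real_diag_herm n (r : 'I_n -> R) : real_diag r \is hermsymmx.
Proof. exact/hermsymmxP/real_diag_adj. Qed.

(** [spectralmx] of a diagonal matrix is not known explicitly, so the equality is checked on the
    standard basis vectors, which are eigenvectors. *)
Lemma funcalc_real_diag f n (r : 'I_n -> R) :
  funcalc f (real_diag r) = real_diag (f \o r).
Proof.
apply/matrixP => i j.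
have /(funcalc_eigen f (real_diag_herm r)) :
    real_diag r *m (delta_mx j 0 : 'cV_n) = (r j)%:C *: delta_mx j 0.
  apply/colP => k; rewrite mul_diag_mx !mxE.
  by have [->|kj] := eqVneq k j; rewrite ?mulr0.
rewrite -colE => /colP/(_ i); rewrite mxE => ->; rewrite !mxE andbT;
  case: eqVneq => [->|_].
  by rewrite mulr1.
by rewrite mulr0.
Qed.

Lemma real_diag_spectrum (I : interval R) n (r : 'I_n -> R) :
  (forall i, r i \in I) -> spectrum_in I (real_diag r).
Proof.
move=> rI a /eigenvalueP[w /rowP wE /rV0Pn[j wj]]; exists (r j) => //.
by have := wE j; rewrite mul_mx_diag !mxE mulrC => /(mulIf wj).
Qed.

Lemma rank_one_psd n (v : 'cV[R[i]]_n) : psdmx (v *m v^t*).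
Proof.
split; first by apply/hermsymmxP; rewrite trmx_mul map_mxM trmxCK.
move=> w; rewrite !mulmxA -mulmxA.
have -> : w^t* *m v = (v^t* *m w)^t* by rewrite trmx_mul map_mxM trmxCK.
set z := v^t* *m w; rewrite mxE big_ord1 !mxE mulrC; exact: mul_conjC_ge0.
Qed.

(** A left eigenvector [w] for [a] makes [a |w|^2] a value of a positive definite form, and
    positivity in [R[i]] includes being real. *)
Lemma positive_add_spectrum n (r : 'I_n -> R) (b : 'M[R[i]]_n) :
  (forall i, 0 < r i) -> psdmx b -> spectrum_in `]0, +oo[ (real_diag r + b).
Proof.
move=> r0 [_ bpos] a /eigenvalueP[w wE w0].
have w2 : 0 < \sum_i `|w 0 i| ^+ 2.
  have [j wj] := rV0Pn _ w0; rewrite (bigD1 j) //=.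
  by rewrite ltr_pwDl ?exprn_gt0 ?normr_gt0 // sumr_ge0 // => i _;
    rewrite exprn_ge0.
have dotw : (w *m w^t*) 0 0 = \sum_i `|w 0 i| ^+ 2.
  by rewrite mxE; apply: eq_bigr => i _; rewrite !mxE normCK.
have : 0 < (w *m (real_diag r + b) *m w^t*) 0 0.
  rewrite mulmxDr mulmxDl mxE ltr_pwDl //; last by have := bpos (w^t*);
    rewrite trmxCK.
  have [j wj] := rV0Pn _ w0; rewrite mxE (bigD1 j) //=.
  have E i : (w *m real_diag r) 0 i * (w^t*) i 0 = (r i)%:C * `|w 0 i| ^+ 2.
    by rewrite mul_mx_diag !mxE normCK mulrAC mulrC.
  rewrite ltr_pwDl ?E ?mulr_gt0 ?exprn_gt0 ?normr_gt0 ?ltcR // sumr_ge0 // => i _.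
  by rewrite E; apply: mulr_ge0; [rewrite ler0c ltW | rewrite exprn_ge0].
rewrite wE -scalemxAl mxE dotw pmulr_lgt0 // ltcE /= => /andP[/eqP a0 a1].
exists (complex.Re a); first by rewrite in_itv /= a1.
by apply/eqP; rewrite eq_complex /= a0 !eqxx.
Qed.

(* The columns [v / (s_j - t)] are eigenvectors of [diag t + v v^T] exactly
   when [s_j] solves the secular equation [sum_i v_i^2 / (s_j - t_i) = 1]. *)
Lemma monotone_rank_one f n (t v w : 'I_n -> R) m (s b : 'I_m -> R) :
  n_monotone `]0, +oo[ f n ->
  (forall i, 0 < t i) -> (forall i j, s j != t i) ->
  (forall j, \sum_i v i ^+ 2 / (s j - t i) = 1) ->
  (forall i, w i = \sum_j b j * (v i / (s j - t i))) ->
  \sum_i f (t i) * w i ^+ 2 <=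
  \sum_j f (s j) * (b j * \sum_i w i * (v i / (s j - t i))).
Proof.
move=> fmono t0 st sec wE; set X := real_diag t; set V := real_col v.
have VV : V *m V^t* = V *m V^T by rewrite real_col_adj.
pose Y := X + V *m V^t*; pose U j := real_col (fun i => v i / (s j - t i)).
have Yherm : Y \is hermsymmx.
  apply/hermsymmxP; rewrite linearD map_mxD real_diag_adj; congr (_ + _).
  by have [/hermsymmxP] := rank_one_psd V.
have YU j : Y *m U j = (s j)%:C *: U j.
  rewrite mulmxDl VV -mulmxA; apply/colP => i.
  rewrite mxE mul_diag_mx [(V *m _) i 0]mxE big_ord1 real_col_dot !mxE.
  rewrite (eq_bigr (fun i => v i ^+ 2 / (s j - t i))) => [|k _]; last first.
    by rewrite expr2 mulrA.
  rewrite sec mulr1 -!rmorphM -rmorphD; congr (_%:C).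
  by field; rewrite subr_eq0 st.
have wU : real_col w = \sum_j (b j)%:C *: U j.
  apply/colP => i; rewrite !mxE wE rmorph_sum summxE; apply: eq_bigr => j _.
  by rewrite !mxE -rmorphM.
have := (fmono X Y (real_diag_herm _) Yherm).
case.
- by apply: real_diag_spectrum => i; rewrite in_itv /= t0.
- exact: positive_add_spectrum (rank_one_psd V).
- by rewrite /loewner_le /Y addrC addKr; exact: rank_one_psd.
move=> _ /(_ (real_col w)); rewrite real_col_adj mulmxBr mulmxBl.
rewrite [X in 0 <= X]mxE [X in _ + X]mxE subr_ge0.
rewrite funcalc_real_diag real_diag_quad.
have -> : ((real_col w)^T *m funcalc f Y *m real_col w) 0 0
  = (\sum_j f (s j) * (b j * \sum_i w i * (v i / (s j - t i))))%:C.
  rewrite -mulmxA [in X in _ *m (_ *m X)]wU mulmx_sumr mulmx_sumr summxE rmorph_sum.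
  apply: eq_bigr => j _; rewrite -scalemxAr (funcalc_eigen f Yherm (YU j)).
  by rewrite -!scalemxAr [LHS]mxE [X in _ * X]mxE real_col_dot -!rmorphM mulrCA.
by rewrite lecR.
Qed.

(** Let [P] and [Q] be the monic polynomials with roots [T] and [S]. With [v x ^+ 2 = - Q x / P' x],
    [secular_equation] makes the points of [S] the eigenvalues of [diag T + v v^T]; the sign
    hypothesis makes [v] real and nonzero. *)
Lemma monotone_dd_tuple f n (T S : n.-tuple R) (p : {poly R}) :
  n_monotone `]0, +oo[ f n -> (forall x, x \in T -> 0 < x) -> uniq (T ++ S) ->
  (forall x, x \in T ->
     0 < - (\prod_(y <- S) (x - y) / \prod_(y <- T | y != x) (x - y))) ->
  (size p <= n)%N -> 0 <= dd (T ++ S) (fun x => p.[x] ^+ 2 * f x).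
Proof.
move=> fmono T0 uTS; have := uTS; rewrite cat_uniq => /and3P[uT /hasPn dTS uS].
set P := fun x => \prod_(y <- T) (x - y); set Q := fun x => \prod_(y <- S) (x - y).
set P' := fun x => \prod_(y <- T | y != x) (x - y).
pose Q' x := \prod_(y <- S | y != x) (x - y).
move=> vpos sp.
pose v x := Num.sqrt (- (Q x / P' x)).
have vv x : x \in T -> v x ^+ 2 = - (Q x / P' x) by move=> /vpos/ltW/sqr_sqrtr.
have v0 x : x \in T -> v x != 0 by move=> /vpos; rewrite -sqrtr_gt0 => /gt_eqF ->.
have uaT s : s \in S -> uniq (s :: T) by move=> sS; rewrite /= dTS.
have uaS t : t \in T -> uniq (t :: S).
  by move=> tT; rewrite /= uS andbT; apply: contraL tT => /dTS.
(* This test vector turns the two quadratic forms into the two halves of the divided difference. At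
   [T], [w x ^+ 2 = - p.[x] ^+ 2 / (P' x * Q x)]; at [S], the coefficient on the eigenvector of [s]
   is [p.[s] / Q' s] and the inner product with it is [p.[s] / P s]. *)
pose w x := - (p.[x] / Q x) * v x.
have wE x : x \in T -> w x = p.[x] / (P' x * v x).
  move=> xT; have Px : P' x != 0.
    rewrite prodf_seq_neq0; apply/allP => y _; apply/implyP => xy.
    by rewrite subr_eq0 eq_sym.
  have Qx : Q x != 0.
    rewrite prodf_seq_neq0; apply/allP => y yS; rewrite subr_eq0.
    by have /andP[] := uaS _ xT => xS _; apply: contraNneq xS => ->.
  have /eqP := vv _ xT; rewrite -subr_eq0 => /eqP E.
  have vx := v0 _ xT.
  have -> : P' x = - Q x / v x ^+ 2.
    by rewrite vv //; field; rewrite Px Qx.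
  by rewrite /w; field; rewrite vx Qx.
have hT i : 0 < tnth T i by rewrite T0 ?mem_tnth.
have hST i j : tnth S j != tnth T i.
  by have := dTS _ (mem_tnth j S); apply: contraNneq => ->; exact: mem_tnth.
have hsec j : \sum_i (v \o tnth T) i ^+ 2 / (tnth S j - tnth T i) = 1.
  rewrite -(secular_equation (uaT _ (mem_tnth j S)) _ (mem_tnth j S)).
    by rewrite big_tuple; apply: eq_bigr => i _; rewrite /= vv ?mem_tnth.
  by rewrite !size_tuple.
have hw i : (w \o tnth T) i =
    \sum_j p.[tnth S j] / Q' (tnth S j) * ((v \o tnth T) i / (tnth S j - tnth T i)).
  rewrite /=; set x := tnth T i; have xT : x \in T by exact: mem_tnth.
  rewrite /w -(partial_fractionN (uaS _ xT)) ?size_tuple // mulr_suml big_tuple.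
  by apply: eq_bigr => j _; rewrite invfM; ring.
have := monotone_rank_one fmono hT hST hsec hw.
rewrite -subr_ge0; congr (0 <= _); rewrite dd_cat // [RHS]addrC; congr (_ + _).
  rewrite [RHS]big_tuple; apply: eq_bigr => j _; set s := tnth S j.
  have sS : s \in S by exact: mem_tnth.
  suff -> : \sum_i (w \o tnth T) i * ((v \o tnth T) i / (s - tnth T i))
    = p.[s] / P s.
    by rewrite [RHS]mulrC invfM -/(P s) -/(Q' s); ring.
  rewrite -(partial_fraction (uaT _ sS)) ?size_tuple // big_tuple.
  apply: eq_bigr => i _ /=; set x := tnth T i.
  have xT : x \in T by exact: mem_tnth.
  have vx := v0 _ xT; rewrite (wE _ xT) -/(P' x) !invfM; have : v x / v x
    = 1 by rewrite divff.
  move=> vvx; transitivity (p.[x] * (P' x)^-1 * (s - x)^-1 * (v x / v x));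
    first by ring.
  by rewrite vvx mulr1; ring.
rewrite -sumrN [RHS]big_tuple; apply: eq_bigr => i _ /=; set x := tnth T i.
have xT : x \in T by exact: mem_tnth.
have vx := v0 _ xT; rewrite expr2 {1}(wE _ xT) /w invfM -/(P' x) -/(Q x).
rewrite invfM; transitivity (p.[x] ^+ 2 * f x * ((P' x)^-1 * (Q x)^-1) * (v x /
  v x)); first by ring.
by rewrite divff // mulr1.
Qed.
End MonotoneDividedDifference.

(** * Splitting the nodes into interlacing halves *)

Section Nodes.
Context {R : realType}.

Lemma prod_below_ratio (a : R) (s1 s2 : seq R) : size s1 = size s2 ->
  (forall y, y \in s1 -> a < y) -> (forall y, y \in s2 -> a < y) ->
  0 < (\prod_(y <- s1) (a - y)) / \prod_(y <- s2) (a - y).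
Proof.
move=> s12 as1 as2.
have E s : \prod_(y <- s) (a - y) = (-1) ^+ size s * \prod_(y <- s) (y - a).
  elim: s => [|y s IH]; first by rewrite !big_nil mulr1.
  by rewrite !big_cons IH exprS; ring.
rewrite !E s12 -mulf_div divff ?signr_eq0 // mul1r.
by apply: divr_gt0; rewrite big_seq prodr_gt0 // => y ys; rewrite subr_gt0;
  [exact: as1|exact: as2].
Qed.

(** [T] takes the smaller and [S] the larger node of each consecutive pair. Seen from [x] in [T],
    every other pair contributes factors of equal sign to the two products, so only the partner of
    [x], which lies above it, decides the sign. *)
Lemma alternate_split n (s : seq R) : sorted <%R s -> size s = n.*2 ->
  exists T S : seq R,
    [/\ size T = n, size S = n, perm_eq s (T ++ S) &
        forall x, x \in T ->
          0 < - (\prod_(y <- S) (x - y) / \prod_(y <- T | y != x) (x - y))].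
Proof.
elim: n s => [|n IH] [|a [|b s]] //=; first by exists [::], [::].
move=> /andP[ab pbs] [sz].
have sbs := order_path_min lt_trans pbs.
have [T [S [sT sS sTS pos]]] := IH s (path_sorted pbs) sz.
have bT y : y \in T -> b < y.
  by move=> yT; apply: (allP sbs); rewrite (perm_mem sTS) mem_cat yT.
have bS y : y \in S -> b < y.
  by move=> yS; apply: (allP sbs); rewrite (perm_mem sTS) mem_cat yS orbT.
exists (a :: T), (b :: S); split => /=; rewrite ?sT ?sS //.
  rewrite perm_cons; apply: (@perm_trans _ (b :: (T ++ S)));
    first by rewrite perm_cons.
  by rewrite perm_sym; exact: (permEl (perm_catCA T [:: b] S)).
move=> x; rewrite inE => /orP[/eqP ->|xT].
  have aT : a \notin T by apply/negP => /bT; rewrite lt_gtF // .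
  rewrite !big_cons eqxx /= prod_other_notin //.
  rewrite -mulrA -mulNr mulr_gt0 //; first by rewrite opprB subr_gt0.
  by apply: prod_below_ratio; rewrite ?sT ?sS //; [move=> y /bS|move=> y /bT];
    exact: lt_trans.
rewrite !big_cons; have bx := bT _ xT; have ax := lt_trans ab bx.
rewrite lt_eqF //= -mulf_div -mulrN mulr_gt0 ?pos //.
by rewrite divr_gt0 ?subr_gt0.
Qed.

Lemma monotone_dd (f : R -> R) n (s : seq R) (p : {poly R}) :
  n_monotone `]0, +oo[ f n -> uniq s -> {in s, forall x, 0 < x} ->
  size s = n.*2 -> (size p <= n)%N -> 0 <= dd s (fun x => p.[x] ^+ 2 * f x).
Proof.
move=> fmono us s0 sz sp.
have szs : size (sort <=%R s) = n.*2 by rewrite size_sort.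
have [|T [S [sT sS sTS pos]]] := alternate_split _ szs.
  by rewrite lt_sorted_uniq_le sort_uniq us sort_le_sorted.
have sTS' : perm_eq s (T ++ S) by rewrite -(permPr sTS) perm_sym perm_sort.
rewrite (dd_perm _ sTS').
have := @monotone_dd_tuple R f n (Tuple (introT eqP sT)) (Tuple (introT eqP sS))
  p fmono.
apply => //=.
- by move=> x xT; apply: s0; rewrite (perm_mem sTS') mem_cat xT.
- by rewrite -(perm_uniq sTS').
Qed.
End Nodes.

(** * Nodes moving to a limit or to infinity *)

Section NodeLimits.
Context {R : realType}.
Implicit Types (s : seq R) (g : R -> R).

(** The share of the fixed nodes in [dd (e :: s) g]. It converges even where [g] has no limit at
    [a], as needed when a node is sent to [0]. *)
Lemma cvg_other_nodes (a : R) s g : a \notin s ->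
  \sum_(x <- s) g x / ((x - e) * \prod_(y <- s | y != x) (x - y)) @[e --> a^'+]
    --> \sum_(x <- s) g x / ((x - a) * \prod_(y <- s | y != x) (x - y)).
Proof.
move=> aNs; rewrite [X in _ --> X]big_seq.
under eq_fun do rewrite big_seq.
apply: cvg_big => [|x xs]; first by apply: add_continuous.
have xa : x - a != 0 by rewrite subr_eq0; apply: contraNneq aNs => <-.
apply: cvgM; first exact: cvg_cst.
under eq_fun do rewrite invfM.
rewrite invfM; apply: cvgM; last exact: cvg_cst.
apply: cvgV => //; apply: cvgB; first exact: cvg_cst.
by apply: cvg_at_right_filter; exact: cvg_id.
Qed.

Lemma near_right_notin (a : R) s : \forall e \near a^'+, e \notin s.
Proof.
elim: s => [|x s IH]; first exact: nearW.
have [xa|ax] := leP x a; near=> e; rewrite inE negb_or; apply/andP; split.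
- by rewrite gt_eqF // (le_lt_trans xa) //; near: e; exact: nbhs_right_gt.
- by near: e.
- by rewrite lt_eqF //; near: e; exact: nbhs_right_lt.
- by near: e.
Unshelve. all: by end_near. Qed.

Lemma cvg_dd_node (a : R) s g : a \notin s -> g e @[e --> a^'+] --> g a ->
  dd (e :: s) g @[e --> a^'+] --> dd (a :: s) g.
Proof.
move=> aNs ga; rewrite dd_cons //.
apply: (@cvg_trans _ ((fun e => g e / \prod_(y <- s) (e - y)
    + \sum_(x <- s) g x / ((x - e) * \prod_(y <- s | y != x) (x - y))) @ a^'+)).
  apply: near_eq_cvg; near=> e; rewrite dd_cons //.
  by near: e; exact: near_right_notin.
apply: cvgD; last exact: cvg_other_nodes.
apply: cvgM => //; apply: cvgV.
  rewrite prodf_seq_neq0; apply/allP => y ys /=; rewrite subr_eq0.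
  by apply: contraNneq aNs => ->.
elim: s {aNs} => [|y s IH].
  by under eq_fun do rewrite big_nil; rewrite big_nil; exact: cvg_cst.
under eq_fun do rewrite big_cons; rewrite big_cons; apply: cvgM => //.
apply: cvgB; last exact: cvg_cst.
by apply: cvg_at_right_filter; exact: cvg_id.
Unshelve. all: by end_near. Qed.

(* A node sent to infinity. *)
Lemma dd_far_node s g (p : {poly R}) : uniq s -> {in s, forall x, 0 < x} ->
  (forall c, uniq (c :: s) -> 0 < c ->
     0 <= dd (c :: s) (fun x => (('X - c%:P) * p).[x] ^+ 2 * g x)) ->
  dd s (fun x => p.[x] ^+ 2 * g x) <= 0.
Proof.
move=> us s0 H; rewrite leNgt; apply/negP => B0.
set B := dd s _ in B0.
pose A := dd s (fun x => x * (p.[x] ^+ 2 * g x)).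
(* The first bound makes [c] larger than every node, hence a new node; the second makes [c * B]
   exceed [A], against the sign of [A - c * B]. *)
pose c := Num.max (1 + \sum_(x <- s) x) (1 + `|A| / B).
have c1 : 1 + \sum_(x <- s) x <= c by rewrite le_max lexx.
have c2 : 1 + `|A| / B <= c by rewrite le_max lexx orbT.
have c0 : 0 < c.
  apply: lt_le_trans c1; rewrite ltr_pwDl // big_seq sumr_ge0 // => x /s0;
    exact: ltW.
have uc : uniq (c :: s).
  rewrite /= us andbT; apply/negP => cs; move: c1; rewrite (big_rem c) //= .
  rewrite leNgt; apply/negP/negPn; rewrite addrCA ltrDl ltr_pwDl // big_seq
    sumr_ge0 // => x.
  by move=> /mem_rem /s0; exact: ltW.
have := H c uc c0.
rewrite (eq_dd (h := fun x => (x - c) * ((x - c) * (p.[x] ^+ 2 * g x))))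
  => [|x _]; last first.
  by rewrite hornerM hornerXsubC exprMn; ring.
rewrite dd_factor //.
rewrite (eq_dd (h := fun x => x * (p.[x] ^+ 2 * g x) + (- c) * (p.[x] ^+ 2 * g
  x))) => [|x _]; last by ring.
rewrite ddD ddZ -/A -/B mulNr subr_ge0 leNgt => /negP; apply.
have : (1 + `|A| / B) * B <= c * B by rewrite ler_pM2r.
rewrite mulrDl divfK ?gt_eqF // mul1r; apply: lt_le_trans.
by rewrite (le_lt_trans (ler_norm A)) // ltrDr.
Qed.
End NodeLimits.

(** * A class of functions stable under shifts *)

Section LoewnerClass.
Context {R : realType}.
Implicit Types (s : seq R) (phi psi f : R -> R).

(* For [phi t = \int 1 / (l + (1 - l) t) dmu(l)] the signed divided difference
   below equals
   [\int l^j (1 - l)^(N-1-j) / \prod_(y <- s) (l + (1 - l) y) dmu(l)],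
   where [N = size s]. *)
Definition loewner_on (D : R -> Prop) phi : Prop :=
  forall s j, uniq s -> {in s, forall x, 0 < x /\ D x} -> (j < size s)%N ->
    0 <= (-1) ^+ (size s + j).+1 * dd s (fun x => x ^+ j * phi x).

Notation loewner := (loewner_on (fun=> True)).

(** The parities of [size s] and [j] decide. For an even number of nodes and odd [j], [monotone_dd]
    applies directly with a power of ['X]; for an odd number and even [j], a further node tends to
    [0]. In the two remaining cases a node is first sent to infinity, which reverses the sign. *)
Lemma operator_monotone_loewner f : (forall t, 0 < t -> 0 < f t) ->
  operator_monotone `]0, +oo[ f -> loewner (fun t => f t / t).
Proof.
move=> fpos fmono.
have even_pos m s (p : {poly R}) : uniq s -> {in s, forall x, 0 < x} ->
    size s = m.*2 -> (size p <= m)%N -> 0 <= dd s (fun x => p.[x] ^+ 2 * f x).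
  by move=> us s0 sz sp; apply: (monotone_dd (fmono m)).
have odd_pos m s (p : {poly R}) : uniq s -> {in s, forall x, 0 < x} ->
    size s = m.*2.+1 -> (size p <= m.+1)%N ->
    0 <= dd s (fun x => p.[x] ^+ 2 * (f x / x)).
  move=> us s0 sz sp.
  have s00 : 0 \notin s by apply/negP => /s0; rewrite ltxx.
  rewrite (_ : dd s _ = \sum_(x <- s) p.[x] ^+ 2 * f x / ((x
    - 0) * \prod_(y <- s | y != x) (x - y))); last first.
    by rewrite /dd; apply: eq_bigr => x _; rewrite subr0 invfM !mulrA.
  apply: cvgr_to_ge (@cvg_other_nodes R 0 s (fun x => p.[x] ^+ 2 * f x) s00) _.
  near=> e.
  have es : e \notin s by near: e; exact: near_right_notin.
  have e0 : 0 < e by near: e; exact: nbhs_right_gt.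
  have : 0 <= dd (e :: s) (fun x => p.[x] ^+ 2 * f x).
    apply: (even_pos m.+1); rewrite //= ?es ?sz // => x.
    by rewrite inE => /orP[/eqP ->//|/s0].
  (* The term of [e] is nonpositive, since [f e] is positive and an odd number of factors [e - y]
     are negative for small [e]; dropping it leaves a nonnegative sum. *)
  rewrite dd_cons // => /le_trans; apply; rewrite gerDr.
  have -> : \prod_(y <- s) (e - y) = - \prod_(y <- s) (y - e).
    have -> : \prod_(y <- s) (e - y) = (-1) ^+ size s * \prod_(y <- s) (y - e).
      elim: (s) => [|y s' IH]; first by rewrite !big_nil mulr1.
      by rewrite !big_cons IH exprS; ring.
    by rewrite sz exprS -muln2 exprM sqrr_sign mulr1 mulN1r.
  rewrite invrN mulrN oppr_le0 divr_ge0 //.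
    by rewrite mulr_ge0 ?sqr_ge0 // ltW // fpos.
  rewrite big_seq prodr_ge0 // => y ys; rewrite subr_ge0 ltW //.
  move: y ys; near: e.
  elim: (s) s0 => [_|y s' IH s0]; first by apply: nearW.
  have y0 : 0 < y by apply: s0; rewrite mem_head.
  have {}IH := IH (fun x xs => s0 x (mem_behead (xs : x \in behead (y :: s')))).
  near=> e => z; rewrite inE => /orP[/eqP ->|].
    by near: e; exact: nbhs_right_lt.
  by move: z; near: e.
move=> s j us s0 js.
have {}s0 : {in s, forall x, 0 < x} by move=> x /s0[].
have posc c : 0 < c -> {in c :: s, forall x, 0 < x}.
  by move=> c0 x; rewrite inE => /orP[/eqP ->//|/s0].
have XcX i c : size (('X - c%:P) * 'X^i : {poly R}) = i.+2.
  by rewrite size_Mmonic ?monicXn ?polyXsubC_eq0 // size_XsubC size_polyXn addnS.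
have E1 i : j = i.*2 ->
    dd s (fun x => x ^+ j * (f x / x)) = dd s (fun x => 'X^i.[x] ^+ 2 * (f x / x)).
  by move=> ->; apply: eq_dd => x _; rewrite hornerXn -exprM muln2.
have E2 i : j = i.*2.+1 ->
    dd s (fun x => x ^+ j * (f x / x)) = dd s (fun x => 'X^i.[x] ^+ 2 * f x).
  move=> ->; apply: eq_dd => x /s0 x0; rewrite hornerXn -exprM muln2 exprSr.
  by field; rewrite gt_eqF.
have jE := odd_double_half j; have sE := odd_double_half (size s).
rewrite -signr_odd oddS oddD.
case: (odd j) jE => /= jE; case: (odd (size s)) sE => /= sE;
  rewrite ?expr0 ?expr1 ?mul1r ?mulN1r ?oppr_ge0.
- rewrite (E2 j./2); last by lia.
  apply: (dd_far_node us s0) => c uc c0.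
  apply: (even_pos (size s)./2.+1) => //; [exact: posc|by rewrite /=; lia|].
  by rewrite XcX; lia.
- rewrite (E2 j./2); last by lia.
  by apply: (even_pos (size s)./2) => //; rewrite ?size_polyXn; lia.
- rewrite (E1 j./2); last by lia.
  by apply: (odd_pos (size s)./2) => //; rewrite ?size_polyXn; lia.
- rewrite (E1 j./2); last by lia.
  apply: (dd_far_node us s0) => c uc c0.
  apply: (odd_pos (size s)./2) => //; [exact: posc|by rewrite /=; lia|].
  by rewrite XcX; lia.
Unshelve. all: by end_near. Qed.
End LoewnerClass.

Local Notation loewner := (loewner_on (fun=> True)).

(** * The shift operation on the class *)

Section LoewnerShift.
Context {R : realType}.
Implicit Types (s : seq R) (phi psi f : R -> R) (D : R -> Prop).

Lemma loewner_ge0 D phi x : loewner_on D phi -> 0 < x -> D x -> 0 <= phi x.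
Proof.
move=> H x0 Dx; have := H [:: x] 0%N isT.
rewrite /dd big_seq1 big_mkcond big_seq1 eqxx /= divr1 expr0 mul1r sqrrN expr1n
  mul1r.
by apply=> // y; rewrite inE => /eqP ->.
Qed.

Lemma dd_pair (x y : R) g : x != y -> dd [:: x; y] g = (g y - g x) / (y - x).
Proof.
move=> xy; have xy' : y != x by rewrite eq_sym.
rewrite /dd !big_cons !big_nil !eqxx (negPf xy) (negPf xy') /=.
by field; rewrite !subr_eq0 xy xy'.
Qed.

Lemma loewner_nonincreasing D phi x y : loewner_on D phi ->
  0 < x -> D x -> D y -> x <= y -> phi y <= phi x.
Proof.
move=> H x0 Dx Dy; rewrite le_eqVlt => /orP[/eqP -> //|xy].
have y0 := lt_trans x0 xy; have := H [:: x; y] 0%N.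
rewrite dd_pair ?lt_eqF //= !mul1r -signr_odd /= mulN1r.
rewrite inE lt_eqF // -mulNr pmulr_lge0 ?invr_gt0 ?subr_gt0 // opprB subr_ge0.
by apply=> // z; rewrite !inE => /orP[]/eqP ->.
Qed.

Lemma loewner_mul_nondecreasing D phi x y : loewner_on D phi ->
  0 < x -> D x -> D y -> x <= y -> x * phi x <= y * phi y.
Proof.
move=> H x0 Dx Dy; rewrite le_eqVlt => /orP[/eqP -> //|xy].
have y0 := lt_trans x0 xy; have := H [:: x; y] 1%N.
rewrite dd_pair ?lt_eqF //= !expr1 -signr_odd /= mul1r.
rewrite inE lt_eqF // pmulr_lge0 ?invr_gt0 ?subr_gt0 // subr_ge0.
by apply=> // z; rewrite !inE => /orP[]/eqP ->.
Qed.

Lemma eq_loewner_on D phi psi :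
  (forall x, 0 < x -> D x -> phi x = psi x) -> loewner_on D phi -> loewner_on D psi.
Proof.
move=> E H s j us sD js; have := H s j us sD js; congr (_ <= _ * _).
by apply: eq_dd => x /sD[x0 Dx]; rewrite E.
Qed.

(** For [e > 1], monotonicity of [phi] and of [t * phi t] squeezes [phi e] between [phi 1 / e] and
    [phi 1]. *)
Lemma loewner_right_continuous phi : loewner phi -> phi e @[e --> 1^'+] --> phi 1.
Proof.
move=> H; apply: (@squeeze_cvgr _ _ _ _ (fun e => phi 1 / e) (cst (phi 1))).
- near=> e; have e1 : 1 < e by near: e; exact: nbhs_right_gt.
  have e0 : 0 < e by exact: lt_trans e1.
  rewrite (loewner_nonincreasing H _ _ _ (ltW e1)) // andbT ler_pdivrMr //.
  by rewrite mulrC -[X in X <= _]mul1r (loewner_mul_nondecreasing H _ _ _ (ltW e1)).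
- rewrite -[X in _ --> X]divr1; apply: cvgM; first exact: cvg_cst.
  by apply: cvgV => //; apply: cvg_at_right_filter; exact: cvg_id.
- exact: cvg_cst.
Unshelve. all: by end_near. Qed.

(** A divided difference with a node at [1] is the limit of those whose node approaches [1] from the
    right, so the sign conditions off [1] carry over. *)
Lemma loewner_extend phi : loewner_on (fun x => x != 1) phi ->
  phi e @[e --> 1^'+] --> phi 1 -> loewner phi.
Proof.
move=> H phi1 s j us s0 js.
have [s1|s1] := boolP (1 \in s); last first.
  by apply: H => // x xs; split; [have [] := s0 _ xs|apply: contraNneq s1 => <-].
have sE := perm_to_rem s1; have := us; rewrite (perm_uniq sE) => /andP[rN ru].
rewrite (dd_perm _ sE).
apply: (@cvgr_to_ge _ _ _ _ (fun e : R => (-1) ^+ (size s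
  + j).+1 * dd (e :: rem 1 s) (fun x => x ^+ j * phi x)) _ _ (cvgM (cvg_cst _)
  (@cvg_dd_node R 1 _ _ rN _))).
  by apply: cvgM => //; apply: cvg_at_right_filter; exact: exprn_continuous.
near=> e.
have e1 : 1 < e by near: e; exact: nbhs_right_gt.
have eN : e \notin rem 1 s by near: e; exact: near_right_notin.
rewrite (perm_size sE); apply: (H (e :: rem 1 s)) => /=; first by rewrite eN.
  move=> x; rewrite inE => /orP[/eqP ->|xs].
    by rewrite gt_eqF //; split=> //; exact: lt_trans e1.
  split; first by have [] := s0 x (mem_rem xs).
  by apply: contraTneq xs => ->.
by rewrite -(perm_size sE : size s = (size (rem 1 s)).+1).
Unshelve. all: by end_near. Qed.

(* For [phi t = \int 1 / (l + (1 - l) t) dmu(l)], the function [psi] corresponds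
   to the measure [l dmu(l)] and [phi - psi] to [(1 - l) dmu(l)]. *)
Lemma loewner_shift phi : loewner phi -> exists psi : R -> R,
  [/\ loewner psi, loewner (fun t => phi t - psi t) &
      forall t, (t - 1) * psi t = t * phi t - phi 1].
Proof.
move=> H; pose q t := (t * phi t - phi 1) / (t - 1).
have one_cons s : {in s, forall x : R, 0 < x /\ x != 1} -> uniq s ->
    uniq (1 :: s) /\ {in 1 :: s, forall x, 0 < x /\ True}.
  move=> s0 us; split=> [|x]; last by rewrite inE => /orP[/eqP ->//|/s0[]].
  by rewrite /= us andbT; apply/negP => /s0[_]; rewrite eqxx.
(* The quotient is the polynomial [1 + x + ... + x^(j-1)], of degree too small to contribute. *)
have geom s j : {in s, forall x : R, 0 < x /\ x != 1} -> uniq s -> (j < size s)%N ->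
    dd s (fun x => (x ^+ j - 1) / (x - 1)) = 0.
  move=> s0 us js; rewrite (eq_dd (h := horner (\poly_(i < j) 1)))
    => [|x /s0[_ x1]].
    by rewrite dd_poly // (leq_ltn_trans (size_poly _ _)).
  have x1' : x - 1 != 0 by rewrite subr_eq0.
  rewrite horner_poly subrX1 mulrAC divff // mul1r.
  by apply: eq_bigr => i _; rewrite mul1r.
(* Adding the node [1] and one more power of [x] leaves the sign unchanged. Subtracting the constant
   [phi 1] then produces a factor [x - 1], which removes the node again. *)
have Hq : loewner_on (fun x => x != 1) q.
  move=> s j us s0 js; have [us1 s01] := one_cons s s0 us.
  have := H (1 :: s) j.+1 us1 s01 js.
  suff -> : dd (1 :: s) (fun x => x ^+ j.+1 * phi x) = dd s (fun x => x ^+ j * q x).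
    by rewrite /= addSn addnS [X in _ <= X * _ -> _]exprS [X in -1 * X]exprS
      mulrA mulrNN !mul1r.
  rewrite -[LHS]subr0 -(dd_const (phi 1) us1) ?ltnS; last by case: (s) js.
  rewrite -ddN -ddD (eq_dd (h := fun x => (x - 1) * (x ^+ j * q x
    + phi 1 * ((x ^+ j - 1) / (x - 1))))); last first.
    move=> x; rewrite inE => /orP[/eqP ->|/s0[_ x1]];
      first by rewrite subrr mul0r expr1n mul1r subrr.
    by rewrite /q exprS; field; rewrite subr_eq0.
  by rewrite dd_factor // ddD ddZ geom // mulr0 addr0.
(* Here only the node [1] is added; the resulting change of sign is absorbed by [phi x - q x = -
   (phi x - phi 1) / (x - 1)]. *)
have Hr : loewner_on (fun x => x != 1) (fun t => phi t - q t).
  move=> s j us s0 js; have [us1 s01] := one_cons s s0 us.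
  have := H (1 :: s) j us1 s01 (leqW js).
  suff -> : dd (1 :: s) (fun x => x ^+ j * phi x) = - dd s (fun x
    => x ^+ j * (phi x - q x)).
    by rewrite /= !addSn exprS mulrN mulN1r mulNr opprK.
  rewrite -[LHS]subr0 -(dd_const (phi 1) us1) ?ltnS; last by case: (s) js.
  rewrite -[X in _ + X = _]ddN -[LHS]ddD (eq_dd (h := fun x => (x
    - 1) * (- (x ^+ j * (phi x - q x)) + phi 1 * ((x ^+ j - 1) / (x - 1)))));
    last first.
    move=> x; rewrite inE => /orP[/eqP ->|/s0[_ x1]];
      first by rewrite subrr mul0r expr1n mul1r subrr.
    by rewrite /q; field; rewrite subr_eq0.
  by rewrite dd_factor // ddD ddZ geom // mulr0 addr0 ddN.
(* Off [1], [q] is nonincreasing, and to the right of [1] it is bounded by its value at [1 / 2], an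
   arbitrary choice in []0, 1[]. *)
have [l ql] : exists l : R, q e @[e --> 1^'+] --> l.
  exists (sup (q @` `]1, +oo[)); apply: nonincreasing_at_right_cvgr => //.
    move=> x y; rewrite !in_itv /= !andbT => x1 y1 xy.
    by apply: (loewner_nonincreasing Hq); rewrite ?gt_eqF // (lt_trans _ x1).
  exists (q (1 / 2)) => _ [x + <-]; rewrite /= in_itv /= andbT => x1.
  have h1 : (1 / 2 : R) < 1 by lra.
  have h2 : (1 / 2 : R) <= x by exact/ltW/(lt_trans h1).
  by apply: (loewner_nonincreasing Hq _ _ _ h2);
    [lra|rewrite lt_eqF|rewrite gt_eqF].
(* At [1] the quotient [q] only has the default value [0] of a division by zero, so the right limit
   is put there. *)
pose psi t := if t == 1 then l else q t.
have psiq x : x != 1 -> psi x = q x by rewrite /psi => /negPf ->.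
have psi1 : psi 1 = l by rewrite /psi eqxx.
have psil : psi e @[e --> 1^'+] --> psi 1.
  rewrite psi1; apply: cvg_trans ql; apply: near_eq_cvg.
  by near=> e; rewrite psiq //; near: e; exact: nbhs_right_neq.
exists psi; split.
- by apply: loewner_extend => //; apply: eq_loewner_on Hq => x _ x1; rewrite psiq.
- apply: loewner_extend; first by apply: eq_loewner_on Hr => x _ x1; rewrite psiq.
  by apply: cvgB => //; exact: loewner_right_continuous.
- move=> t; have [->|t1] := eqVneq t 1; first by rewrite subrr mul0r mul1r subrr.
  by rewrite psiq // /q mulrC divfK // subr_eq0.
Unshelve. all: by end_near. Qed.
End LoewnerShift.

(** * Iterated shifts *)

Section LoewnerFamily.
Context {R : realType}.
Implicit Types (phi psi f : R -> R).

(** The relation determines [psi] away from [1], where it agrees with the function given by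
    [loewner_shift]; right continuity recovers the point [1]. *)
Lemma loewner_shift_compl phi psi : loewner phi -> loewner psi ->
  (forall t, (t - 1) * psi t = t * phi t - phi 1) ->
  loewner (fun t => phi t - psi t).
Proof.
move=> Hphi Hpsi E; have [psi' [_ H' E']] := loewner_shift Hphi.
apply: loewner_extend; last by apply: cvgB; exact: loewner_right_continuous.
apply: (@eq_loewner_on _ _ (fun t => phi t - psi' t)) => [x x0 x1|].
  have x1' : x - 1 != 0 by rewrite subr_eq0.
  by congr (_ - _); apply: (mulfI x1'); rewrite E E'.
by move=> s j us s0; apply: H' => // x /s0[].
Qed.

(* [Phi n k] corresponds to the measure [l^n (1 - l)^k dmu(l)]. *)
Lemma loewner_family phi : loewner phi -> exists Phi : nat -> nat -> R -> R,
  [/\ Phi 0%N 0%N = phi, forall n k, loewner (Phi n k),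
      forall n k t, Phi n k.+1 t = Phi n k t - Phi n.+1 k t &
      forall n k t, (t - 1) * Phi n.+1 k t = t * Phi n k t - Phi n k 1].
Proof.
move=> Hphi.
have /boolp.choice[S HS] (psi : R -> R) : exists S : R -> R, loewner psi ->
    loewner S /\ forall t, (t - 1) * S t = t * psi t - psi 1.
  have [Hpsi|] := pselect (loewner psi); last by exists psi.
  by have [S [HS _ E]] := loewner_shift Hpsi; exists S.
pose D (F : nat -> R -> R) n t := F n t - F n.+1 t.
(* [n] shifts of [phi], then [k] differences in [n], since [l^n - l^(n+1) = l^n (1 - l)]. *)
pose Phi n k := iter k D (fun n => iter n S phi) n.
have H k : (forall n, loewner (Phi n k)) /\
    (forall n t, (t - 1) * Phi n.+1 k t = t * Phi n k t - Phi n k 1).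
  elim: k => [|k [IH1 IH2]].
    have H0 n : loewner (Phi n 0%N) by elim: n => //= n /HS[].
    by split=> // n t; have [_ ->] := HS _ (H0 n).
  split=> n; first exact: (loewner_shift_compl (IH1 n) (IH1 n.+1) (IH2 n)).
  by move=> t; rewrite /Phi /= /D -/(Phi n.+1 k) -/(Phi n k) -/(Phi n.+2 k)
    mulrBr !IH2; ring.
by exists Phi; split=> // n k; have [] := H k.
Qed.

Lemma family_ge0 (Phi : nat -> nat -> R -> R) n k t :
  (forall n k, loewner (Phi n k)) -> 0 < t -> 0 <= Phi n k t.
Proof. by move=> H t0; exact: loewner_ge0 (H n k) t0 _. Qed.

(** Raising [k], or raising [n] at [k = 0], never increases the value. The bound is uniform in [n]
    and [k] and controls the remainders in [mean_kernel]. *)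
Lemma family_le (Phi : nat -> nat -> R -> R) n k t :
  (forall n k, loewner (Phi n k)) ->
  (forall n k t, Phi n k.+1 t = Phi n k t - Phi n.+1 k t) ->
  0 < t -> Phi n k t <= Phi 0%N 0%N t.
Proof.
move=> H Hc t0; apply: (@le_trans _ _ (Phi n 0%N t)).
  elim: k => // k; apply: le_trans; rewrite Hc gerBl; exact: family_ge0.
elim: n => // n; apply: le_trans.
by have := family_ge0 n 1 H t0; rewrite Hc subr_ge0.
Qed.
End LoewnerFamily.

(** * Finite expansions with remainder *)

Section Expansions.
Context {R : fieldType}.
Variables (a d : nat -> nat -> R) (t : R).
Hypothesis a_compl : forall n k, a n k.+1 = a n k - a n.+1 k.
Hypothesis a_shift : forall n k, (t - 1) * a n.+1 k = t * a n k - d n k.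

(** Iterates [a n 0 = (d n 0 + (t - 1) * a n.+1 0) / t]. It is applied both to the family [Phi] at
    [t] and pointwise to the kernel, which gives them matching partial sums. *)
Lemma expansion_pow n : t != 0 ->
  a 0%N 0%N = t^-1 * (\sum_(i < n) ((t - 1) / t) ^+ i * d i 0%N)
    + ((t - 1) / t) ^+ n * a n 0%N.
Proof.
move=> tn0; elim: n => [|n ->]; first by rewrite big_ord0 mulr0 add0r mul1r.
rewrite big_ord_recr /= mulrDr -addrA; congr (_ + _).
have -> : a n 0%N = t^-1 * (d n 0%N + (t - 1) * a n.+1 0%N).
  by rewrite a_shift addrC subrK mulKf.
by rewrite exprSr; ring.
Qed.

(** Iterates [a 0 n = d 0 n + (1 - t) * a 0 n.+1], obtained by eliminating [a 1 n] between the two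
    relations. *)
Lemma expansion_compl_pow n :
  a 0%N 0%N = \sum_(i < n) (1 - t) ^+ i * d 0%N i + (1 - t) ^+ n * a 0%N n.
Proof.
elim: n => [|n ->]; first by rewrite big_ord0 add0r mul1r.
rewrite big_ord_recr /= -addrA; congr (_ + _).
have := a_shift 0%N n; rewrite a_compl exprSr => E.
have -> : d 0%N n = t * a 0%N n - (t - 1) * a 1%N n by rewrite E; ring.
by ring.
Qed.
End Expansions.

(** * The Hausdorff moment problem *)

Section Means.
Context {R : realType}.
Implicit Types (f g h : R -> R) (L : (R -> R) -> R).

Definition bmeas f : Prop :=
  measurable_fun (`[0, 1] : set R) f /\
  exists C, forall x, 0 <= x <= 1 -> `|f x| <= C.

(** A positive normalized linear functional on bounded Borel functions. Countable additivity is not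
    demanded, as an ultrafilter limit need not have it. *)
Definition mean L : Prop :=
  [/\ L (fun=> 1) = 1,
      forall a f g, bmeas f -> bmeas g -> L (fun x => a * f x + g x) = a * L f
        + L g &
      forall f g, bmeas f -> bmeas g -> (forall x, 0 <= x <= 1 -> f x <= g x) ->
        L f <= L g].

Section Hausdorff.
Variable d : nat -> nat -> R.
Hypothesis d_ge0 : forall n k, 0 <= d n k.
Hypothesis d_compl : forall n k, d n k.+1 = d n k - d n.+1 k.

(** Pascal's rule for [N] iterations of [d n k = d n k.+1 + d n.+1 k]. For [n = 0] it gives the
    total mass of the Bernstein weights. *)
Lemma binomial_mass n N : \sum_(k < N.+1) 'C(N, k)%:R * d (n + k) (N - k) = d n 0.
Proof.
elim: N => [|N IH]; first by rewrite big_ord_recl big_ord0 bin0 mul1r addr0 addn0.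
rewrite -IH big_ord_recl bin0 mul1r addn0 subn0.
under eq_bigr => k _ do rewrite lift0 binS natrD mulrDl subSS addnS.
rewrite big_split /= [in X in _ + (X + _)]big_ord_recr /= bin_small // mul0r addr0.
rewrite addrA addrC; have -> : d n N.+1 + \sum_(i < N) 'C(N, i.+1)%:R * d (n
  + i).+1 (N - i)
    = \sum_(k < N.+1) 'C(N, k)%:R * d (n + k) (N - k).+1.
  rewrite [RHS]big_ord_recl bin0 mul1r addn0 subn0; congr (_ + _).
  by apply: eq_bigr => i _; rewrite lift0 addnS -subSn // subSS.
rewrite -big_split; apply: eq_bigr => k _.
by rewrite /= d_compl -mulrDr addrC subrK.
Qed.
End Hausdorff.

(** Falling factorials, unlike powers, have exact Bernstein moments:
    [k * 'C(N, k) = N * 'C(N.-1, k.-1)] lowers [n], and the induction hypothesis is used for [d]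
    shifted in its first index. *)
Lemma binomial_factorial_moment (d : nat -> nat -> R) n N :
  (forall n k, d n k.+1 = d n k - d n.+1 k) ->
  \sum_(k < N.+1) 'C(N, k)%:R * d k (N - k)%N * (k ^_ n)%:R = (N ^_ n)%:R * d n 0%N.
Proof.
elim: n N d => [|n IH] N d dc.
  rewrite ffactn0 mul1r -(binomial_mass dc 0 N).
  by apply: eq_bigr => k _; rewrite ffactn0 mulr1 add0n.
rewrite big_ord_recl ffact0n mulr0 add0r.
case: N => [|N]; first by rewrite big_ord0 ffact0n mul0r.
rewrite ffactSS natrM -mulrA -(IH N (fun i k => d i.+1 k)) // mulr_sumr.
apply: eq_bigr => k _; rewrite lift0 ffactSS subSS natrM.
rewrite !mulrA -natrM mul_bin_diag /= mulnC natrM; ring.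
Qed.

(** Replacing one factor [(k - n) / N] by [k / N] costs at most [n / N], also where the subtraction
    truncates; these costs add up to at most [n^2 / N]. *)
Lemma factorial_power_ratio n N k : (k <= N)%N -> (0 < N)%N ->
  `|(k ^_ n)%:R / N%:R ^+ n - (k%:R / N%:R) ^+ n| <= (n ^ 2)%:R / N%:R :> R.
Proof.
move=> kN N0; have N0' : 0 < N%:R :> R by rewrite ltr0n.
have ratio1 m : (m <= N)%N -> 0 <= (m%:R / N%:R : R) <= 1.
  by move=> mN; rewrite divr_ge0 // ler_pdivrMr // mul1r ler_nat.
elim: n => [|n IH]; first by rewrite ffactn0 !expr0 divr1 subrr normr0 mul0r.
rewrite ffactnSr natrM exprSr invfM.
set a := (k ^_ n)%:R / N%:R ^+ n in IH *.
have -> : (k ^_ n)%:R * (k - n)%:R * (N%:R ^- n * N%:R^-1) = a * ((k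
  - n)%:R / N%:R) :> R.
  by rewrite /a; ring.
rewrite exprSr; set b := k%:R / N%:R in IH *; set r := (k - n)%:R / N%:R.
have /andP[r0 r1] : 0 <= r <= 1 by apply: ratio1;
  rewrite (leq_trans (leq_subr _ _)).
have /andP[b0 b1] : 0 <= b <= 1 by exact: ratio1.
have rb : `|r - b| <= n%:R / N%:R.
  rewrite distrC ger0_norm ?subr_ge0 -?mulrBl ?ler_pM2r ?invr_gt0 // ?ler_nat
    ?leq_subr //.
  by rewrite lerBlDr -natrD ler_nat; lia.
have -> : a * r - b ^+ n * b = (a - b ^+ n) * r + b ^+ n * (r - b) by ring.
apply: (le_trans (ler_normD _ _)); rewrite (normrM (a
  - b ^+ n)) (normrM (b ^+ n)) (ger0_norm r0) (ger0_norm (exprn_ge0 n b0)).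
apply: (@le_trans _ _ ((n ^ 2)%:R / N%:R + n%:R / N%:R)).
  apply: lerD; first by rewrite -[leRHS]mulr1 ler_pM.
  by rewrite -[leRHS]mul1r ler_pM // ?exprn_ge0 ?exprn_ile1.
by rewrite -mulrDl ler_pM2r ?invr_gt0 // -natrD ler_nat; lia.
Qed.

(** The image of an ultrafilter is an ultrafilter, hence converges on the compact interval
    [[- C, C]]. *)
Lemma ultra_bounded_cvg (U : set_system nat) (u : nat -> R) C : UltraFilter U ->
  (forall n, `|u n| <= C) -> cvg (u n @[n --> U]).
Proof.
move=> UU uC.
have fmU : UltraFilter (u n @[n --> U]).
  split; first exact: fmap_proper_filter.
  move=> G PG UG; apply/seteqP; split=> // A GA.
  have [//|UnA] := in_ultra_setVsetC (u @^-1` A) UU.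
  by have [x [Ax nAx]] := filter_ex (filterI GA (UG (~` A) UnA)); case: (nAx Ax).
have := @segment_compact R (- C) C; rewrite compact_ultra => /(_ _ fmU)[].
  by apply: (@filterE nat U _ (u @^-1` `[- C, C])) => n;
    rewrite /= in_itv /= -ler_norml.
by move=> p [_ up]; apply/cvg_ex; exists p.
Qed.

(* An ultrafilter limit of the Bernstein measures with mass ['C(N, k) d k (N - k)]
   at [k / N] spares the extraction of a convergent subsequence. *)
Lemma hausdorff_mean (d : nat -> nat -> R) : (forall n k, 0 <= d n k) ->
  (forall n k, d n k.+1 = d n k - d n.+1 k) -> d 0%N 0%N = 1 ->
  exists2 L, mean L & forall n, L (fun x => x ^+ n) = d n 0%N.
Proof.
move=> d0 dc d1.
pose w N k := 'C(N, k)%:R * d k (N - k)%N.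
have w0 N k : 0 <= w N k by rewrite mulr_ge0.
have w1 N : \sum_(k < N.+1) w N k = 1.
  by rewrite -d1 -(binomial_mass dc 0 N); apply: eq_bigr => k _; rewrite add0n.
pose M N h := \sum_(k < N.+1) w N k * h (k%:R / N%:R).
(* For [N = 0] the division by zero returns [0], still a point of the unit interval. *)
have unit_ratio N (k : 'I_N.+1) : 0 <= (k%:R / N%:R : R) <= 1.
  rewrite divr_ge0 //=; case: N k => [|N] k; first by rewrite invr0 mulr0.
  by rewrite ler_pdivrMr ?ltr0n // mul1r ler_nat -ltnS.
have [U [UU ooU]] := ultraFilterLemma (@eventually_filter).
have Mcvg h : bmeas h -> cvg (M N h @[N --> U]).
  case=> _ [C hC]; apply: (@ultra_bounded_cvg U (M^~ h) C UU) => N.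
  rewrite -[C]mul1r -(w1 N) mulr_suml (le_trans (ler_norm_sum _ _ _)) // ler_sum
    // => k _.
  by rewrite normrM ger0_norm // ler_wpM2l // hC.
exists (fun h => lim (M N h @[N --> U])).
  split.
  - apply: cvg_lim => //; rewrite (_ : (fun N => M N (fun=> 1)) = cst 1);
    first exact: cvg_cst.
    apply/funext => N; rewrite -[RHS]/(1 : R) -[RHS](w1 N).
    by apply: eq_bigr => k _; rewrite mulr1.
  - move=> a f g bf bg; apply: cvg_lim => //.
    rewrite (_ : (fun N => M N (fun x => a * f x + g x)) = (fun N => a * M N f
      + M N g)).
      by apply: cvgD; [apply: cvgM; [exact: cvg_cst|exact: Mcvg]|exact: Mcvg].
    apply/funext => N; rewrite mulr_sumr -big_split; apply: eq_bigr => k _ /=.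
    by ring.
  - move=> f g bf bg fg; apply: ler_lim; [exact: Mcvg|exact: Mcvg|].
    by apply: filterE => N; apply: ler_sum => k _; rewrite ler_wpM2l // fg.
move=> n; apply: cvg_lim => //.
(* [U] refines the filter at infinity, so ordinary convergence suffices for powers. *)
have : M N (fun x => x ^+ n) @[N --> \oo] --> d n 0%N; last first.
  by apply: cvg_trans; exact: cvg_app.
apply/cvgrPdist_le => e e0.
have near_e : \forall N \near \oo, (n ^ 2)%:R / N%:R * (1 + d n 0%N) <= e.
  near=> N.
  have N0 : 0 < N%:R :> R by rewrite ltr0n; near: N; exact: nbhs_infty_gt.
  rewrite mulrAC ler_pdivrMr // -ler_pdivrMl // ltW //.
  by near: N; exact: nbhs_infty_gtr.
near=> N.
have N0 : (0 < N)%N by near: N; exact: nbhs_infty_gt.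
have Ne : (n ^ 2)%:R / N%:R * (1 + d n 0%N) <= e by near: N.
apply: le_trans Ne.
(* The exact factorial moment is inserted and cancels; what remains are two errors bounded by
   [factorial_power_ratio]. *)
have -> : d n 0%N - M N (fun x => x ^+ n) =
    - (\sum_(k < N.+1) w N k * ((k%:R / N%:R) ^+ n - (k ^_ n)%:R / N%:R ^+ n))
    + ((N%:R / N%:R) ^+ n - (N ^_ n)%:R / N%:R ^+ n) * d n 0%N.
  rewrite mulrBl divff ?pnatr_eq0 -?lt0n // expr1n mul1r.
  have -> : (N ^_ n)%:R / N%:R ^+ n * d n 0%N = (\sum_(k < N.+1) w N k * (k ^_
    n)%:R) / N%:R ^+ n.
    by rewrite (binomial_factorial_moment n N dc); ring.
  rewrite mulr_suml; under [X in - X + _]eq_bigr do rewrite mulrBr.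
  rewrite sumrB opprB [RHS]addrC -addrA; congr (_ + _).
  rewrite (eq_bigr (fun k : 'I_N.+1 => w N k * ((k ^_ n)%:R / N%:R ^+ n)))
    => [|k _].
    by rewrite addKr.
  by rewrite mulrA.
apply: (le_trans (ler_normD _ _)); rewrite mulrDr mulr1; apply: lerD.
  have -> : (n ^ 2)%:R / N%:R = \sum_(k < N.+1) w N k * ((n ^ 2)%:R / N%:R) :> R.
    by rewrite -mulr_suml w1 mul1r.
  rewrite normrN (le_trans (ler_norm_sum _ _ _)) //.
  apply: ler_sum => k _; rewrite normrM ger0_norm // ler_wpM2l // distrC.
  by apply: factorial_power_ratio => //; rewrite -ltnS.
rewrite normrM (ger0_norm (d0 _ _)) ler_wpM2r // distrC.
exact: factorial_power_ratio.
Unshelve. all: by end_near. Qed.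
End Means.

(** * From means to measures *)

Section MeanComparison.
Context {R : realType}.
Implicit Types (f g h : R -> R) (L : (R -> R) -> R).

Lemma bmeas_cst (c : R) : bmeas (fun=> c).
Proof. by split; [exact: measurable_cst|exists `|c|]. Qed.

Lemma bmeas_lin (a : R) f g : bmeas f -> bmeas g -> bmeas (fun x => a * f x + g x).
Proof.
move=> [mf [C hC]] [mg [C' hC']]; split.
  by apply: measurable_funD => //; apply: measurable_funM => //;
    exact: measurable_cst.
exists (`|a| * C + C') => x x01; rewrite (le_trans (ler_normD _ _)) // lerD ?hC' //.
by rewrite normrM ler_wpM2l // hC.
Qed.

Lemma bmeas_continuous f : {in `[0, 1], forall x : R, {for x,
  continuous f}} -> bmeas f.
Proof.
move=> cf.
have cf' : {within `[0%R, 1%R], continuous f}.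
  by apply: continuous_in_subspaceT => x /set_mem /=; exact: cf.
split; first exact: subspace_continuous_measurable_fun.
have [||c _ hc] := @EVT_max R (fun x => `|f x|) 0 1 => //.
  move=> x; apply: continuous_comp; first exact: cf'.
  exact: norm_continuous.
by exists `|f c| => x x01; apply: hc; rewrite in_itv.
Qed.

Definition tail (a : R) : R -> R := \1_(`]a, +oo[%classic : set R).

Lemma tailE (a x : R) : tail a x = (a < x)%R%:R.
Proof. by rewrite /tail indicE mem_setE in_itv /= andbT. Qed.

Lemma bmeas_tail (a : R) : bmeas (tail a).
Proof.
split; first exact: measurable_indic.
by exists 1 => x _; rewrite tailE; case: (a < x); rewrite ?normr1 ?normr0.
Qed.

Section OneMean.
Variable L : (R -> R) -> R.
Hypothesis HL : mean L.

Lemma mean_lin (a : R) f g : bmeas f -> bmeas g -> L (fun x => a * f x + g x)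
  = a * L f + L g.
Proof. by case: HL => _ + _; exact. Qed.

Lemma mean_le f g : bmeas f -> bmeas g -> (forall x, 0 <= x <= 1 -> f x <= g x)
  -> L f <= L g.
Proof. by case: HL => _ _; exact. Qed.

Lemma mean_eq f g : bmeas f -> bmeas g -> (forall x, 0 <= x <= 1 -> f x
  = g x) -> L f = L g.
Proof. by move=> bf bg fg; apply/le_anti/andP; split; apply: mean_le
  => // x /fg ->. Qed.

Lemma mean_cst (c : R) : L (fun=> c) = c.
Proof.
have L1 : L (fun=> 1) = 1 by case: HL.
have L0 : L (fun=> 0) = 0.
  have : L (fun=> 0) = 1 * L (fun=> 0) + L (fun=> 0).
    rewrite -mean_lin; [|exact: bmeas_cst|exact: bmeas_cst].
    by congr L; apply/funext => x; rewrite mulr0 addr0.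
  by rewrite mul1r => /eqP; rewrite eq_sym -subr_eq0 addrK => /eqP.
rewrite (_ : (fun=> c) = (fun x => c * (fun=> 1) x + (fun=> 0) x));
  last by apply/funext => x; rewrite mulr1 addr0.
by rewrite mean_lin ?L1 ?L0 ?mulr1 ?addr0 //; exact: bmeas_cst.
Qed.

Lemma mean_dist f g (c : R) : bmeas f -> bmeas g ->
  (forall x, 0 <= x <= 1 -> `|f x - g x| <= c) -> `|L f - L g| <= c.
Proof.
move=> bf bg fg.
have key u v : bmeas u -> bmeas v -> (forall x, 0 <= x <= 1 -> `|u x
  - v x| <= c) -> L u - L v <= c.
  move=> bu bv uv; rewrite lerBlDr addrC -[X in _ + X](mean_cst c) -[L v]mul1r
    -mean_lin //; last exact: bmeas_cst.
  apply: mean_le => //; first by apply: bmeas_lin => //; exact: bmeas_cst.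
  by move=> x /uv; rewrite mul1r ler_norml => /andP[_]; rewrite lerBlDr addrC.
rewrite ler_norml -lerNl opprB !key // => x x01.
by rewrite distrC fg.
Qed.
End OneMean.

(* [step h N m] is [h] evaluated at the next multiple of [1/N], on [0, m/N]. *)
Definition step h N m : R -> R := fun x =>
  h 0 + \sum_(i < m) (h (i.+1%:R / N%:R) - h (i%:R / N%:R)) * tail (i%:R / N%:R) x.

Lemma bmeas_step h N m : bmeas (step h N m).
Proof.
elim: m => [|m IH].
  rewrite (_ : step h N 0 = fun=> h 0); first exact: bmeas_cst.
  by apply/funext => x; rewrite /step big_ord0 addr0.
rewrite (_ : step h N m.+1 = (fun x => (h (m.+1%:R / N%:R)
  - h (m%:R / N%:R)) * tail (m%:R / N%:R) x + step h N m x)).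
  by apply: bmeas_lin => //; exact: bmeas_tail.
by apply/funext => x; rewrite /step big_ord_recr /= addrA addrC.
Qed.

Lemma mean_step L h N m : mean L ->
  L (step h N m) = h 0 + \sum_(i < m) (h (i.+1%:R / N%:R)
    - h (i%:R / N%:R)) * L (tail (i%:R / N%:R)).
Proof.
move=> HL; elim: m => [|m IH].
  rewrite (_ : step h N 0 = fun=> h 0) ?mean_cst ?big_ord0 ?addr0 //.
  by apply/funext => x; rewrite /step big_ord0 addr0.
rewrite (_ : step h N m.+1 = (fun x => (h (m.+1%:R / N%:R)
  - h (m%:R / N%:R)) * tail (m%:R / N%:R) x + step h N m x)).
  rewrite mean_lin //; [|exact: bmeas_tail|exact: bmeas_step].
  by rewrite IH big_ord_recr /= [RHS]addrA addrC.
by apply/funext => x; rewrite /step big_ord_recr /= addrA addrC.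
Qed.

Lemma step_approx h (K : R) N m x : (0 < N)%N -> (m <= N)%N -> 0 <= K ->
  (forall x y, 0 <= x <= 1 -> 0 <= y <= 1 -> `|h x - h y| <= K * `|x - y|) ->
  0 <= x <= m%:R / N%:R -> `|step h N m x - h x| <= K / N%:R.
Proof.
move=> N0 + K0 hK; have N0' : 0 < N%:R :> R by rewrite ltr0n.
elim: m => [|m IH] mN.
  rewrite mul0r => /le_anti <-; rewrite /step big_ord0 addr0 subrr normr0.
  by rewrite divr_ge0.
move=> /andP[x0 xm]; have [xm'|mx] := leP x (m%:R / N%:R).
  rewrite (_ : step h N m.+1 x = step h N m x); first by apply: IH;
    [exact: ltnW|rewrite x0].
  by rewrite /step big_ord_recr /= tailE ltNge xm' /= mulr0 addr0.
have -> : step h N m.+1 x = h (m.+1%:R / N%:R).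
  rewrite /step (eq_bigr (fun i : 'I_m.+1 => h (i.+1%:R / N%:R)
    - h (i%:R / N%:R))) => [|i _].
    rewrite -(big_mkord xpredT (fun i => h (i.+1%:R / N%:R) - h (i%:R / N%:R))).
    by rewrite telescope_sumr // mul0r addrC subrK.
  rewrite tailE (le_lt_trans _ mx) ?mulr1 // ler_pM2r ?invr_gt0 // ler_nat -ltnS.
  exact: ltn_ord.
have mN1 : m.+1%:R / N%:R <= 1 :> R by rewrite ler_pdivrMr // mul1r ler_nat.
apply: (le_trans (hK _ _ _ _)).
- by rewrite mN1 divr_ge0.
- by rewrite x0 (le_trans xm).
- apply: ler_wpM2l => //; rewrite ger0_norm ?subr_ge0 // lerBlDr.
  rewrite -[m.+1]addn1 natrD mulrDl mul1r addrC lerD2l; exact: ltW.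
Qed.

(** The hypotheses place [L2 (tail a)] between [L1 (tail b)], for any [b > a], and [L1 (tail a)].
    For a step function of mesh [1 / N] the discrepancies of the tails telescope to at most [1],
    each multiplied by an increment of at most [K / N]. *)
Lemma eq_mean_lipschitz L1 L2 h (K : R) : mean L1 -> mean L2 ->
  (forall a, L2 (tail a) <= L1 (tail a)) ->
  (forall a b, a < b -> L1 (tail b) <= L2 (tail a)) ->
  bmeas h -> 0 <= K ->
  (forall x y, 0 <= x <= 1 -> 0 <= y <= 1 -> `|h x - h y| <= K * `|x - y|) ->
  L1 h = L2 h.
Proof.
move=> H1 H2 T21 T12 bh K0 hK.
have tail01 a : 0 <= L1 (tail a) <= 1.
  apply/andP; split.
    rewrite -(mean_cst H1 0); apply: (mean_le H1) (bmeas_cst _) (bmeas_tail _) _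
      => x _.
    by rewrite tailE.
  rewrite -[leRHS](mean_cst H1 1); apply: (mean_le H1) (bmeas_tail _) (bmeas_cst
    _) _ => x _.
  by rewrite tailE; case: (a < x); rewrite ?ler01.
(* The [3] counts the replacement of [h] by [step h N N] under each mean and the comparison of the
   means on that step function. *)
have bound N : (0 < N)%N -> `|L1 h - L2 h| <= 3 * K / N%:R.
  move=> N0; have N0' : 0 < N%:R :> R by rewrite ltr0n.
  have near L : mean L -> `|L (step h N N) - L h| <= K / N%:R.
    move=> HL; apply: (mean_dist HL (bmeas_step _ _ _) bh) => x x01.
    by apply: step_approx => //; rewrite divff ?gt_eqF.
  have steps : `|L1 (step h N N) - L2 (step h N N)| <= K / N%:R.
    rewrite !mean_step // opprD addrACA subrr add0r -sumrB.
    apply: (le_trans (ler_norm_sum _ _ _)).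
    apply: (@le_trans _ _ (\sum_(i < N) K / N%:R * (L1 (tail (i%:R / N%:R))
      - L1 (tail (i.+1%:R / N%:R))))).
      apply: ler_sum => i _; rewrite -mulrBr normrM.
      have iN : (i < N)%N by [].
      have lt_i : i%:R / N%:R < i.+1%:R / N%:R :> R by rewrite ltr_pM2r
        ?invr_gt0 // ltr_nat.
      apply: ler_pM => //.
        apply: (le_trans (hK _ _ _ _)).
        - by rewrite divr_ge0 //= ler_pdivrMr // mul1r ler_nat.
        - by rewrite divr_ge0 //= ler_pdivrMr // mul1r ler_nat ltnW.
        - by rewrite -mulrBl -[i.+1]addn1 natrD addrAC subrr add0r mul1r
          ger0_norm ?invr_ge0.
      rewrite ger0_norm ?subr_ge0 // lerB //.
      exact: T12.
    rewrite -mulr_sumr -[leRHS]mulr1 ler_wpM2l ?divr_ge0 //.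
    rewrite -(big_mkord xpredT (fun i => L1 (tail (i%:R / N%:R))
      - L1 (tail (i.+1%:R / N%:R)))).
    rewrite (eq_bigr (fun i => - (L1 (tail (i.+1%:R / N%:R))
      - L1 (tail (i%:R / N%:R))))) => [|i _]; last by rewrite opprB.
    rewrite sumrN telescope_sumr // opprB.
    have /andP[_ t1] := tail01 (0%:R / N%:R); have /andP[t2 _] := tail01 (N%:R /
      N%:R).
    by rewrite lerBlDr (le_trans t1) // lerDl.
  have -> : L1 h - L2 h = - (L1 (step h N N) - L1 h) + (L1 (step h N N)
    - L2 (step h N N)) + (L2 (step h N N) - L2 h) by ring.
  apply: (le_trans (ler_normD _ _)).
  have -> : 3 * K / N%:R = K / N%:R + K / N%:R + K / N%:R by ring.
  apply: lerD; last exact: near.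
  by apply: (le_trans (ler_normD _ _)); apply: lerD; rewrite ?normrN //;
    exact: near.
apply/eqP; rewrite -subr_eq0 -normr_le0 leNgt; apply/negP => D0.
have [N hN] : exists N : nat, 3 * K / `|L1 h - L2 h| < N%:R.
  by exists (Num.bound (3 * K / `|L1 h - L2 h|)); apply: archi_boundP;
    rewrite divr_ge0 // mulr_ge0.
have N0 : (0 < N)%N.
  by rewrite -(ltr_nat R) (le_lt_trans _ hN) // divr_ge0 // mulr_ge0.
have := bound N N0; rewrite leNgt => /negP; apply.
by rewrite ltr_pdivrMr ?ltr0n // [ltRHS]mulrC -ltr_pdivrMr.
Qed.
End MeanComparison.

(** * Distribution function and measure of a mean *)

Section MeanMeasure.
Context {R : realType}.
Implicit Types (f g h : R -> R) (L : (R -> R) -> R).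

Section Cdf.
Variable L : (R -> R) -> R.
Hypothesis HL : mean L.

Lemma mean_tail_ge0 a : 0 <= L (tail a).
Proof.
rewrite -(mean_cst HL 0); apply: (mean_le HL (bmeas_cst _) (bmeas_tail _)) => x _.
by rewrite tailE.
Qed.

Lemma mean_tail_le1 a : L (tail a) <= 1.
Proof.
rewrite -(mean_cst HL 1); apply: (mean_le HL (bmeas_tail _) (bmeas_cst _)) => x _.
by rewrite tailE; case: (a < x); rewrite ?ler01.
Qed.

Lemma mean_tail_mono a b : a <= b -> L (tail b) <= L (tail a).
Proof.
move=> ab; apply: (mean_le HL (bmeas_tail _) (bmeas_tail _)) => x _; rewrite !tailE.
by case: (ltP b x) => [bx|_]; rewrite ?(le_lt_trans ab bx).
Qed.

Lemma mean_tail_lt0 a : a < 0 -> L (tail a) = 1.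
Proof.
move=> a0; rewrite -[RHS](mean_cst HL 1).
apply: (mean_eq HL (bmeas_tail _) (bmeas_cst _)) => x /andP[x0 _].
by rewrite tailE (lt_le_trans a0).
Qed.

Lemma mean_tail_ge1 a : 1 <= a -> L (tail a) = 0.
Proof.
move=> a1; rewrite -[RHS](mean_cst HL 0).
apply: (mean_eq HL (bmeas_tail _) (bmeas_cst _)) => x /andP[_ x1].
by rewrite tailE ltNge (le_trans x1).
Qed.

(* The right-continuous regularization of [a |-> L 1_{]-oo, a]}]. *)
Definition mean_cdf (HL : mean L) (a : R) : R :=
  inf [set 1 - L (tail b) | b in [set b | a < b]].

Notation F := (mean_cdf HL).

Let lbF a : has_lbound [set 1 - L (tail b) | b in [set b | a < b]].
Proof. by exists 0 => _ [b _ <-]; rewrite subr_ge0 mean_tail_le1. Qed.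

Let neF a : [set 1 - L (tail b) | b in [set b | a < b]] !=set0.
Proof. by exists (1 - L (tail (a + 1))), (a + 1) => //=; rewrite ltrDl. Qed.

Lemma mean_cdf_le a b : a < b -> F a <= 1 - L (tail b).
Proof. by move=> ab; apply: ge_inf => //; exists b. Qed.

Lemma mean_cdf_ge a : 1 - L (tail a) <= F a.
Proof.
apply: lb_le_inf => // _ [b /= ab <-]; rewrite lerB // mean_tail_mono //.
exact: ltW.
Qed.

Lemma mean_cdf_nondecreasing : nondecreasing F.
Proof.
move=> a b; rewrite le_eqVlt => /orP[/eqP -> //|ab].
exact: le_trans (mean_cdf_le ab) (mean_cdf_ge b).
Qed.

Lemma mean_cdf_right_continuous : right_continuous F.
Proof.
move=> a; apply/cvgrPdist_le => e e0.
have [_ [b /= ab <-] hb] := inf_adherent e0 (conj (neF a) (lbF a)).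
near=> x.
have ax : a < x by near: x; exact: nbhs_right_gt.
have xb : x < b by near: x; exact: nbhs_right_lt.
rewrite distrC ger0_norm ?subr_ge0 ?(mean_cdf_nondecreasing (ltW ax)) // lerBlDr
  addrC.
exact: le_trans (mean_cdf_le xb) (ltW hb).
Unshelve. all: by end_near. Qed.

Lemma mean_cdf_lt0 a : a < 0 -> F a = 0.
Proof.
move=> a0; apply/le_anti/andP; split.
  have h : a / 2 < 0 by rewrite pmulr_llt0 ?invr_gt0.
  rewrite -[leRHS](subrr 1) -[X in _ - X](mean_tail_lt0 h); apply: mean_cdf_le.
  lra.
by apply: le_trans (mean_cdf_ge a); rewrite subr_ge0 mean_tail_le1.
Qed.

Lemma mean_cdf_ge1 a : 1 <= a -> F a = 1.
Proof.
move=> a1; apply/le_anti/andP; split.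
  apply: (le_trans (@mean_cdf_le a (a + 1) _)); first by rewrite ltrDl.
  by rewrite gerBl mean_tail_ge0.
by apply: le_trans (mean_cdf_ge a); rewrite mean_tail_ge1 // subr0.
Qed.

Lemma mean_cdfNy : F @ -oo --> (0 : R).
Proof.
apply: cvg_near_cst; near=> x; apply: mean_cdf_lt0.
by near: x; exact: nbhs_ninfty_lt.
Unshelve. all: by end_near. Qed.

Lemma mean_cdfy : F @ +oo --> (1 : R).
Proof.
apply: cvg_near_cst; near=> x; apply: mean_cdf_ge1.
by near: x; exact: nbhs_pinfty_ge.
Unshelve. all: by end_near. Qed.

End Cdf.

HB.instance Definition _ L (HL : mean L) :=
  isCumulative.Build R _ R (mean_cdf HL) (@mean_cdf_nondecreasing L HL)
    (@mean_cdf_right_continuous L HL).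
HB.instance Definition _ L (HL : mean L) :=
  isCumulativeBounded.Build R 0 1 (mean_cdf HL) (@mean_cdfNy L HL) (@mean_cdfy L
    HL).

(** Integration against the Lebesgue-Stieltjes measure of [mean_cdf] is again a mean. Regularization
    may change tails at jumps, but the tails still interlace with those of [L], so
    [eq_mean_lipschitz] applies. *)
Lemma mean_measure L : mean L ->
  exists mu : probability (measurableTypeR R) R,
    mu (~` `[0, 1]) = 0%E /\
    forall h (K : R), bmeas h -> 0 <= K ->
      (forall x y, 0 <= x <= 1 -> 0 <= y <= 1 -> `|h x - h y| <= K * `|x - y|) ->
      (\int[mu]_(x in `[0%R, 1%R]) (h x)%:E)%E = (L h)%:E.
Proof.
move=> HL; pose mu : probability (measurableTypeR R) R :=
  lebesgue_stieltjes_measure (mean_cdf HL).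
have muE a : mu (`]-oo, a]%classic : set R) = (mean_cdf HL a)%:E.
  exact: (cdf_lebesgue_stieltjes_id (mean_cdf HL) a).
have muT a : mu (`]a, +oo[%classic : set R) = (1 - mean_cdf HL a)%:E.
  by rewrite -setCitvl probability_setC // muE.
have mu01 : mu (~` `[0, 1]) = 0%E.
  (* The point [0] may carry an atom, so the open half-line below it is exhausted by closed
     half-lines on which the distribution function vanishes. *)
  pose A n : set R := `]-oo, - n.+1%:R^-1] `|` `]1, +oo[.
  pose B := \bigcup_n A n.
  have sub : ~` `[0, 1] `<=` B.
    move=> x /=; rewrite in_itv /= => /negP; rewrite negb_and -!ltNge
      => /orP[x0|x1].
      exists (Num.bound (- x)^-1) => //; left; rewrite /= in_itv /=.
      rewrite lerNr -[leRHS]invrK lef_pV2 ?posrE ?invr_gt0 ?oppr_gt0 ?ltr0n //.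
      apply: ltW; apply: (lt_trans (archi_boundP _)); rewrite ?ltr_nat ?ltnS //.
      by rewrite invr_ge0 oppr_ge0 ltW.
    by exists 0%N => //; right; rewrite /= in_itv /= x1.
  apply/eqP; rewrite eq_le measure_ge0 andbT.
  have mA n : (measurable : set (set (measurableTypeR R))) (A n) by exact:
    measurableU.
  apply: (@le_trans _ _ (mu B)).
    by apply: le_measure; rewrite ?inE //; [exact: measurableC|apply:
      bigcup_measurable => n _; exact: mA].
  apply: (@le_trans _ _ (\sum_(n <oo) mu (A n))%E).
    by apply: measure_sigma_subadditive => //; apply: bigcup_measurable => n _;
      exact: mA.
  rewrite eseries0 // => n _ _; apply/eqP; rewrite eq_le measure_ge0 andbT.
  apply: (le_trans (measureU2 _ _ _)) => //.
  have N1 : (mu (`]-oo, (- n.+1%:R^-1 : R)%R]%classic : set R) <= 0)%E.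
    by rewrite muE mean_cdf_lt0 // oppr_lt0 invr_gt0 ltr0n.
  have N2 : (mu (`]1%R, +oo[%classic : set R) <= 0)%E.
    by rewrite muT mean_cdf_ge1 // subrr.
  by rewrite -[leRHS]adde0; apply: leeD; [exact: N1|exact: N2].
have fin01 : (mu `[0%R, 1%R]%classic < +oo)%E by rewrite (le_lt_trans
  (probability_le1 _ _)) ?ltry.
have intb f : bmeas f -> mu.-integrable `[0, 1] (EFin \o f).
  move=> [mf [C hC]]; apply: measurable_bounded_integrable => //.
  exists C; split; first exact: num_real.
  move=> M CM x; rewrite /= in_itv /= => /hC /le_trans; apply; exact: ltW.
pose I h := (\int[mu]_(x in `[0, 1]) h x)%R.
have mu1 : mu `[0, 1]%classic = 1%E.
  by rewrite -[`[0, 1]%classic]setCK probability_setC ?mu01 ?sube0 //;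
    exact: measurableC.
have meanI : mean I.
  split.
  - by rewrite /I Rintegral_cst // mul1r; exact: (congr1 fine mu1).
  - move=> a f g bf bg; rewrite /I RintegralD ?RintegralZl //; try exact: intb.
    have : bmeas (fun x => a * f x).
      rewrite (_ : (fun x => _) = (fun x => a * f x + (fun=> 0) x)).
        by apply: bmeas_lin => //; exact: bmeas_cst.
      by apply/funext => x; rewrite addr0.
    exact: intb.
  - move=> f g bf bg fg; apply: le_Rintegral => //; try exact: intb.
have tailI a : I (tail a) = 1 - mean_cdf HL a.
  suff E : mu ((`]a, +oo[%classic : set R) `&` `[0, 1]%classic) = (1
    - mean_cdf HL a)%:E.
    by rewrite /I /Rintegral integral_indic //; exact: (congr1 fine E).
  rewrite -muT; apply/esym; apply: etrans (measureDI mu _ _) _.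
  - exact: (measurable_itv `]a, +oo[).
  - exact: (measurable_itv `[0, 1]).
  rewrite [X in (X + _)%E](_ : _ = 0%E) ?add0e //.
  apply/eqP; rewrite eq_le measure_ge0 andbT -mu01 le_measure ?inE //.
  - by apply: measurableD; exact: measurable_itv.
  - by apply: measurableC; exact: measurable_itv.
exists mu; split => // h K bh K0 hK.
have -> : L h = I h.
  apply: eq_mean_lipschitz bh K0 hK => // [a|a b ab]; rewrite tailI.
  - by rewrite lerBlDr -lerBlDl mean_cdf_ge.
  - by rewrite lerBrDr -lerBrDl mean_cdf_le.
by rewrite /I fineK //; apply: integrable_fin_num => //; exact: intb.
Qed.
End MeanMeasure.

(** * The integral representation *)

Section Representation.
Context {R : realType}.
Implicit Types (f g h phi : R -> R) (L : (R -> R) -> R).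

Definition kernel_denom (t x : R) : R := x + (1 - x) * t.

Lemma kernel_denom_ge (t x : R) : 0 <= x <= 1 -> Num.min 1 t <= kernel_denom t x.
Proof.
move=> /andP[x0 x1]; rewrite /kernel_denom.
have h1 : Num.min 1 t <= 1 by rewrite ge_min lexx.
have ht : Num.min 1 t <= t by rewrite ge_min lexx orbT.
have -> : Num.min 1 t = x * Num.min 1 t + (1 - x) * Num.min 1 t by ring.
apply: lerD; first by rewrite -[leRHS]mulr1 ler_wpM2l.
by rewrite ler_wpM2l // subr_ge0.
Qed.

Lemma kernel_denom_gt0 (t x : R) : 0 < t -> 0 <= x <= 1 -> 0 < kernel_denom t x.
Proof. by move=> t0 x01; rewrite (lt_le_trans _ (kernel_denom_ge t x01)) //
  lt_min ltr01. Qed.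

Lemma kernel_continuous (t : R) : 0 < t ->
  {in `[0, 1], forall x : R, {for x, continuous (fun x => (kernel_denom t x)^-1)}}.
Proof.
move=> t0 x; rewrite in_itv /= => x01; apply: cvgV.
  by rewrite gt_eqF // kernel_denom_gt0.
apply: cvgD; first exact: cvg_id.
by apply: cvgM; [apply: cvgB; [exact: cvg_cst|exact: cvg_id]|exact: cvg_cst].
Qed.

Lemma bmeas_kernel (t : R) : 0 < t -> bmeas (fun x => (kernel_denom t x)^-1).
Proof. by move=> t0; apply: bmeas_continuous; exact: kernel_continuous. Qed.

Lemma bmeas_monomial n k : bmeas (fun x : R => x ^+ n * (1 - x) ^+ k).
Proof.
apply: bmeas_continuous => x _; apply: cvgM; first exact: exprn_continuous.
apply: (@continuous_comp _ _ _ (fun x : R => 1 - x) (fun y => y ^+ k));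
  last exact: exprn_continuous.
by apply: cvgB; [exact: cvg_cst|exact: cvg_id].
Qed.

Lemma kernel_lipschitz (t x y : R) : 0 < t -> 0 <= x <= 1 -> 0 <= y <= 1 ->
  `|(kernel_denom t x)^-1 - (kernel_denom t y)^-1|
    <= `|1 - t| / Num.min 1 t ^+ 2 * `|x - y|.
Proof.
move=> t0 x01 y01.
have m0 : 0 < Num.min 1 t by rewrite lt_min ltr01.
have Dx := kernel_denom_gt0 t0 x01; have Dy := kernel_denom_gt0 t0 y01.
have -> : (kernel_denom t x)^-1 - (kernel_denom t y)^-1
    = - ((1 - t) * (x - y) / (kernel_denom t x * kernel_denom t y)).
  rewrite {3 4}/kernel_denom; move: Dx Dy; rewrite /kernel_denom => Dx Dy.
  by field; rewrite !gt_eqF.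
rewrite normrN !normrM [leRHS]mulrAC ler_wpM2l ?mulr_ge0 // ger0_norm.
  rewrite lef_pV2 ?posrE ?mulr_gt0 ?exprn_gt0 // expr2.
  by apply: ler_pM; rewrite ?(ltW m0) ?kernel_denom_ge.
by rewrite invr_ge0 mulr_ge0 // ltW.
Qed.

Lemma mean_sum L n (c : 'I_n -> R) (g : 'I_n -> R -> R) : mean L ->
  (forall i, bmeas (g i)) ->
  bmeas (fun x => \sum_i c i * g i x) /\ L (fun x => \sum_i c i * g i x)
    = \sum_i c i * L (g i).
Proof.
move=> HL bg; elim: n c g bg => [|n IH] c g bg.
  rewrite big_ord0 (_ : (fun x => _) = fun=> 0); last by apply/funext => x;
    rewrite big_ord0.
  by split; [exact: bmeas_cst|exact: mean_cst].
have [b E] := IH (c \o lift ord0) (g \o lift ord0) (fun i => bg _).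
rewrite (_ : (fun x => _) = (fun x => c ord0 * g ord0 x
  + \sum_i c (lift ord0 i) * g (lift ord0 i) x)).
  split; first exact: (bmeas_lin _ (bg _) b).
  by rewrite (mean_lin HL _ (bg _) b) E big_ord_recl.
by apply/funext => x; rewrite big_ord_recl.
Qed.

Lemma eq_geometric (a b q C : R) : 0 <= q < 1 ->
  (forall n, `|a - b| <= q ^+ n * C) -> a = b.
Proof.
move=> /andP[q0 q1] H; apply/eqP; rewrite -subr_eq0 -normr_le0.
have : q ^+ n * C @[n --> \oo] --> 0 * C.
  by apply: cvgM; [apply: cvg_expr; rewrite ger0_norm|exact: cvg_cst].
by rewrite mul0r => /cvgr_to_ge; apply; apply: nearW.
Qed.

Lemma mean_monomials L (d : nat -> nat -> R) : mean L ->
  (forall n k, d n k.+1 = d n k - d n.+1 k) -> (forall n, L (fun x => x ^+ n)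
    = d n 0%N) ->
  forall n k, L (fun x => x ^+ n * (1 - x) ^+ k) = d n k.
Proof.
move=> HL dc Ld n k; elim: k n => [|k IH] n.
  by rewrite -Ld; congr L; apply/funext => x; rewrite mulr1.
rewrite dc -!IH (_ : (fun x => _) =
  (fun x => -1 * (x ^+ n.+1 * (1 - x) ^+ k) + x ^+ n * (1 - x) ^+ k)); last first.
  by apply/funext => x; rewrite !exprS; ring.
by rewrite (mean_lin HL) ?mulN1r 1?addrC //; exact: bmeas_monomial.
Qed.

(** Since [L] maps [x^n (1 - x)^k] to [Phi n k 1], the expansion of the kernel under [L] and that of
    [Phi 0 0 t] have the same partial sums. Both remainders are geometric, of ratio [(t - 1) / t] if
    [1 <= t] and [1 - t] if [t < 1]. *)
Lemma mean_kernel L (Phi : nat -> nat -> R -> R) (t : R) : mean L ->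
  (forall n k, loewner (Phi n k)) ->
  (forall n k t, Phi n k.+1 t = Phi n k t - Phi n.+1 k t) ->
  (forall n k t, (t - 1) * Phi n.+1 k t = t * Phi n k t - Phi n k 1) ->
  (forall n k, L (fun x => x ^+ n * (1 - x) ^+ k) = Phi n k 1) ->
  0 < t -> L (fun x => (kernel_denom t x)^-1) = Phi 0%N 0%N t.
Proof.
move=> HL H Hc Hs HLd t0.
pose a x n k := x ^+ n * (1 - x) ^+ k / kernel_denom t x.
have ac x n k : a x n k.+1 = a x n k - a x n.+1 k by rewrite /a !exprS; ring.
have as_ x n k : 0 <= x <= 1 ->
    (t - 1) * a x n.+1 k = t * a x n k - x ^+ n * (1 - x) ^+ k.
  move=> x01; have := kernel_denom_gt0 t0 x01.
  rewrite /a /kernel_denom => D0.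
  by rewrite exprS; field; rewrite gt_eqF.
have a00 x : a x 0%N 0%N = (kernel_denom t x)^-1 by rewrite /a !mul1r.
have [p ple] : exists p, forall n k, Phi n k t <= p.
  by exists (Phi 0%N 0%N t) => n k; exact: family_le.
have aub x n k : 0 <= x <= 1 -> 0 <= a x n k <= (Num.min 1 t)^-1.
  move=> x01; have /andP[x0 x1] := x01; have D0 := kernel_denom_gt0 t0 x01.
  have m0 : 0 < Num.min 1 t by rewrite lt_min ltr01.
  have hp : 0 <= x ^+ n * (1 - x) ^+ k <= 1.
    rewrite mulr_ge0 ?exprn_ge0 ?subr_ge0 //=.
    by rewrite mulr_ile1 ?exprn_ge0 ?exprn_ile1 ?subr_ge0 // gerBl.
  have /andP[hp0 hp1] := hp.
  rewrite divr_ge0 ?(ltW D0) //= -[leRHS]mul1r ler_pM ?invr_ge0 ?(ltW D0) //.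
  by rewrite lef_pV2 ?posrE // kernel_denom_ge.
have [t1|t1] := leP 1 t.
  have q0 : 0 <= (t - 1) / t by rewrite divr_ge0 ?subr_ge0 // ltW.
  apply: (@eq_geometric _ _ ((t - 1) / t) ((Num.min 1 t)^-1 + p)).
    by rewrite q0 /= ltr_pdivrMr // mul1r ltrBlDr ltrDl ltr01.
  move=> n.
  have [b E] := @mean_sum L n (fun i => ((t - 1) / t) ^+ i) (fun i x
    => x ^+ i * (1 - x) ^+ 0) HL (fun i => bmeas_monomial i 0).
  pose S := \sum_(i < n) ((t - 1) / t) ^+ i * Phi i 0%N 1.
  (* The added zero function gives the expression the shape [a * f + g] of [mean_lin]. *)
  have LS : L (fun x => t^-1 * (\sum_(i < n) ((t - 1) / t) ^+ i * (x ^+ i * (1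
    - x) ^+ 0)) + (fun=> 0) x) = t^-1 * S.
    rewrite (mean_lin HL) ?E ?mean_cst ?addr0 //; last exact: bmeas_cst.
    by congr (_ * _); apply: eq_bigr => i _; rewrite HLd.
  rewrite (@expansion_pow _ (fun n k => Phi n k t) (fun n k
    => Phi n k 1) t (fun n k => Hs n k t) n) ?gt_eqF //.
  rewrite -/S -LS opprD addrA mulrDr; apply: (le_trans (ler_normB _ _));
    apply: lerD.
    apply: (mean_dist HL); [exact: bmeas_kernel|by apply: bmeas_lin => //;
      exact: bmeas_cst|].
    move=> x x01; rewrite addr0 -a00.
    rewrite (@expansion_pow _ (a x) (fun n k => x ^+ n * (1
      - x) ^+ k) t (fun n k => as_ x n k x01) n) ?gt_eqF // [X in X - _]addrC addrK.
    have /andP[a0 a1] := aub x n 0%N x01.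
    by rewrite ger0_norm ?(mulr_ge0 (exprn_ge0 n q0) a0) // ler_wpM2l // exprn_ge0.
  have pn0 := family_ge0 n 0 H t0.
  by rewrite ger0_norm ?(mulr_ge0 (exprn_ge0 n q0) pn0) // ler_wpM2l // exprn_ge0.
have q0 : 0 <= 1 - t by rewrite subr_ge0 ltW.
apply: (@eq_geometric _ _ (1 - t) ((Num.min 1 t)^-1 + p)).
  by rewrite q0 /= ltrBlDr ltrDl.
move=> n.
have [b E] := @mean_sum L n (fun i => (1 - t) ^+ i) (fun i x => x ^+ 0 * (1
  - x) ^+ i) HL (fun i => bmeas_monomial 0 i).
pose S := \sum_(i < n) (1 - t) ^+ i * Phi 0%N i 1.
have LS : L (fun x => \sum_(i < n) (1 - t) ^+ i * (x ^+ 0 * (1 - x) ^+ i)) = S.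
  by rewrite E; apply: eq_bigr => i _; rewrite HLd.
rewrite (@expansion_compl_pow _ (fun n k => Phi n k t) (fun n k
  => Phi n k 1) t (fun n k => Hc n k t) (fun n k => Hs n k t) n).
rewrite -/S -LS opprD addrA mulrDr; apply: (le_trans (ler_normB _ _)); apply: lerD.
  apply: (mean_dist HL) => //; first exact: bmeas_kernel.
  move=> x x01; rewrite -a00.
  rewrite (@expansion_compl_pow _ (a x) (fun n k => x ^+ n * (1
    - x) ^+ k) t (ac x) (fun n k => as_ x n k x01) n) [X in X - _]addrC addrK.
  have /andP[a0 a1] := aub x 0%N n x01.
  by rewrite ger0_norm ?(mulr_ge0 (exprn_ge0 n q0) a0) // ler_wpM2l // exprn_ge0.
have pn0 := family_ge0 0 n H t0.
by rewrite ger0_norm ?(mulr_ge0 (exprn_ge0 n q0) pn0) // ler_wpM2l // exprn_ge0.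
Qed.
End Representation.

(** * Assembling the representing measure *)

Section FiniteMeasure.
Context {R : realType}.

Section Scale.
Variables (k : {nonneg R}) (P : probability (measurableTypeR R) R).

Lemma mscale_fin : fin_num_fun (mscale k P).
Proof.
move=> A mA; rewrite /mscale /= fin_numM // fin_num_measure //.
Qed.
HB.instance Definition _ := @Measure_isFinite.Build _ _ R (mscale k P) mscale_fin.
End Scale.

(** Dividing by [phi 1] gives a moment sequence starting with [1], hence a probability measure,
    which is then scaled back by [phi 1]. *)
Lemma loewner_representation (phi : R -> R) : loewner phi -> 0 < phi 1 ->
  exists mu : {finite_measure set (measurableTypeR R) -> \bar R},
    on_unit_interval mu /\ represents mu (fun t => t * phi t).
Proof.
move=> H p1.
have Hn : loewner (fun t => (phi 1)^-1 * phi t).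
  move=> s j us s0 js; rewrite (eq_dd (h := fun x => (phi 1)^-1 * (x ^+ j * phi
    x))) => [|x _]; last first.
    by rewrite mulrCA.
  by rewrite ddZ mulrCA mulr_ge0 ?invr_ge0 ?(ltW p1) // H.
have [Phi [Phi00 PhiH Phic Phis]] := loewner_family Hn.
have P0 n k : 0 <= Phi n k 1 by exact: family_ge0.
have P1 : Phi 0%N 0%N 1 = 1 by rewrite Phi00 mulVf // gt_eqF.
have [L HL Lpow] := hausdorff_mean P0 (fun n k => Phic n k 1) P1.
have Lmono := mean_monomials HL (fun n k => Phic n k 1) Lpow.
have [P [P01 Pint]] := mean_measure HL.
pose k := NngNum (ltW p1).
exists (mscale k P); split.
  by rewrite /on_unit_interval /= /mscale /= P01 mule0.
move=> t t0.
have bt : bmeas (fun x => t * (kernel_denom t x)^-1).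
  rewrite (_ : (fun x => _) = (fun x => t * (kernel_denom t x)^-1 + (fun=> 0) x)).
    by apply: bmeas_lin; [exact: bmeas_kernel|exact: bmeas_cst].
  by apply/funext => x; rewrite addr0.
have m0 : 0 < Num.min 1 t by rewrite lt_min ltr01.
rewrite ge0_integral_mscale //=; last 2 first.
- by apply/measurable_EFinP; have [] := bt.
- move=> x; rewrite in_itv /= => x01; rewrite lee_fin divr_ge0 ?ltW //.
  exact: kernel_denom_gt0.
rewrite (Pint _ (t * (`|1 - t| / Num.min 1 t ^+ 2)) bt).
- have -> : L (fun x => t * (kernel_denom t x)^-1) = t * ((phi 1)^-1 * phi t).
    rewrite (_ : (fun x => _) = (fun x => t * (kernel_denom t x)^-1
      + (fun=> 0) x)); last first.
      by apply/funext => x; rewrite addr0.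
    rewrite (mean_lin HL) ?(mean_cst HL) ?addr0;
      [|exact: bmeas_kernel|exact: bmeas_cst].
    by rewrite (mean_kernel HL PhiH Phic Phis Lmono t0) Phi00.
  by rewrite -EFinM; congr (_%:E); rewrite /= mulrCA mulVKf // gt_eqF.
- by rewrite mulr_ge0 ?(ltW t0) // divr_ge0 // exprn_ge0 // ltW.
- move=> x y x01 y01; rewrite -mulrBr normrM gtr0_norm // -mulrA ler_wpM2l ?(ltW
  t0) //.
  exact: kernel_lipschitz.
Qed.
End FiniteMeasure.

(** * The converse *)

(** Polarized form: [u'] and [z'] become the conjugates of [u] and [z], so that the products become
    squared moduli. *)
Lemma kernel_identity (F : fieldType) (l t u z u' z' : F) : l + (1 - l) * t != 0 ->
  l * (t * (u * u')) + (1 - l) * (z * z')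
    - t / (l + (1 - l) * t) * ((l * u + (1 - l) * z) * (l * u' + (1 - l) * z'))
  = l * (1 - l) / (l + (1 - l) * t) * ((t * u - z) * (t * u' - z')).
Proof. by move=> D0; field. Qed.

Section IntegralsAreMonotone.
Local Open Scope complex_scope.
Local Open Scope sesquilinear_scope.
Context {R : realType}.
Implicit Types (f : R -> R) (n : nat).

Lemma loewner_leP n (x y : 'M[R[i]]_n) : x \is hermsymmx -> y \is hermsymmx ->
  loewner_le x y <-> forall v : 'cV[R[i]]_n, (v^t* *m x *m v) 0 0 <= (v^t* *m y
    *m v) 0 0.
Proof.
move=> /hermsymmxP hx /hermsymmxP hy.
have E (v : 'cV[R[i]]_n) : (v^t* *m (y - x) *m v) 0 0
    = (v^t* *m y *m v) 0 0 - (v^t* *m x *m v) 0 0.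
  by rewrite mulmxBr mulmxBl [LHS]mxE [X in _ + X]mxE.
split=> [[_ xy] v|xy]; first by rewrite -subr_ge0 -E.
split=> [|v]; last by rewrite E subr_ge0.
by apply/hermsymmxP; rewrite linearB map_mxB hx hy.
Qed.

Definition quad f n (x : 'M[R[i]]_n) (v : 'cV[R[i]]_n) : R[i] :=
  (v^t* *m funcalc f x *m v) 0 0.

Lemma quadE f n (x : 'M[R[i]]_n) v :
  quad f x v = \sum_i (f (spectral_val x i))%:C * `|(spectralmx x *m v) i 0| ^+ 2.
Proof. by rewrite /quad funcalcE quad_sum. Qed.

Definition sqnorm (z : R[i]) : R := complex.Re (`|z| ^+ 2).

Lemma sqnormE (z : R[i]) : (sqnorm z)%:C = `|z| ^+ 2.
Proof. by apply: RRe_real; rewrite ger0_real // exprn_ge0. Qed.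

Lemma sqnorm_ge0 (z : R[i]) : 0 <= sqnorm z.
Proof. by rewrite -ler0c sqnormE exprn_ge0. Qed.

Lemma quad_real f n (x : 'M[R[i]]_n) v :
  quad f x v =
    (\sum_i f (spectral_val x i) * sqnorm ((spectralmx x *m v) i 0))%:C.
Proof.
rewrite quadE rmorph_sum; apply: eq_bigr => i _.
by rewrite -sqnormE -rmorphM.
Qed.

Lemma quad_cst1 n (x : 'M[R[i]]_n) v : quad (fun=> 1) x v = (v^t* *m v) 0 0.
Proof.
rewrite /quad funcalcE (_ : real_diag _ = 1%:M).
  by rewrite mulmx1 mulmx1C ?mulmx1 //; exact/unitarymxP/spectral_unitarymx.
apply/matrixP => i j; rewrite !mxE /=; by case: (i == j).
Qed.

Lemma quad_id n (x : 'M[R[i]]_n) v : x \is hermsymmx ->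
  quad idfun x v = (v^t* *m x *m v) 0 0.
Proof. by move=> hx; rewrite /quad funcalc_id. Qed.

Lemma spectral_funcalc f n (x : 'M[R[i]]_n) (v : 'cV[R[i]]_n) i :
  (spectralmx x *m (funcalc f x *m v)) i 0
    = (f (spectral_val x i))%:C * (spectralmx x *m v) i 0.
Proof.
rewrite funcalcE !mulmxA; have /unitarymxP -> := spectral_unitarymx x.
by rewrite mul1mx -mulmxA mul_diag_mx !mxE.
Qed.

(* The difference of the two sides is [l (1 - l) |t u - z|^2 / (l + (1 - l) t)]. *)
Lemma kernel_convexity (l t : R) (u z : R[i]) : 0 <= l <= 1 -> 0 < t ->
  (t / kernel_denom t l)%:C * `|l%:C * u + (1 - l)%:C * z| ^+ 2
    <= l%:C * (t%:C * `|u| ^+ 2) + (1 - l)%:C * `|z| ^+ 2.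
Proof.
move=> l01 t0; have D0 := kernel_denom_gt0 t0 l01; have /andP[l0 l1] := l01.
rewrite -subr_ge0.
have -> : l%:C * (t%:C * `|u| ^+ 2) + (1 - l)%:C * `|z| ^+ 2
    - (t / kernel_denom t l)%:C * `|l%:C * u + (1 - l)%:C * z| ^+ 2
    = (l * (1 - l) / kernel_denom t l)%:C * `|t%:C * u - z| ^+ 2.
  have E1 : (1 - l)%:C = 1 - l%:C by rewrite rmorphB rmorph1.
  have E2 : Num.conj (1 - l%:C) = 1 - l%:C by rewrite -E1 conj_real.
  rewrite !normCK !rmorphB !rmorphD !rmorphM /= !conj_real fmorphV /= !E1 E2 (_
    : 1%:C = 1) //.
  have D0' : (kernel_denom t l)%:C != 0.
    by rewrite -(rmorph0 (real_complex R)) (inj_eq (@complexI R)) gt_eqF.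
  have : (kernel_denom t l)%:C = l%:C + (1 - l%:C) * t%:C.
    by rewrite /kernel_denom rmorphD rmorphM rmorphB rmorph1.
  move: D0' => /[swap] ->.
  exact: kernel_identity.
by rewrite mulr_ge0 ?exprn_ge0 // ler0c divr_ge0 ?(ltW D0) // mulr_ge0 // subr_ge0.
Qed.

(** [kernel_convexity] in each coordinate of an eigenbasis of [x], summed. *)
Lemma quad_kernel_le (l : R) n (x : 'M[R[i]]_n) (u z : 'cV[R[i]]_n) :
  0 <= l <= 1 -> (forall i, 0 < spectral_val x i) ->
  quad (fun t => t / kernel_denom t l) x (l%:C *: u + (1 - l)%:C *: z)
    <= l%:C * quad idfun x u + (1 - l)%:C * quad (fun=> 1) x z.
Proof.
move=> l01 d0; rewrite !quadE !mulr_sumr -big_split; apply: ler_sum => i _ /=.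
rewrite mulmxDr -!scalemxAr mxE [X in `|X + _|]mxE [X in `|_ + X|]mxE mul1r.
exact: kernel_convexity.
Qed.

(** Equality in [kernel_convexity] needs [t u = z] for [0 < l < 1]. Together with
    [l u + (1 - l) z = v] this gives [u = v / (l + (1 - l) t)] in each spectral coordinate, which
    [funcalc] realizes as a vector. *)
Lemma quad_kernel_attained (l : R) n (x : 'M[R[i]]_n) (v : 'cV[R[i]]_n) :
  0 <= l <= 1 -> (forall i, 0 < spectral_val x i) ->
  exists u z : 'cV[R[i]]_n, v = l%:C *: u + (1 - l)%:C *: z /\
    quad (fun t => t / kernel_denom t l) x v
      = l%:C * quad idfun x u + (1 - l)%:C * quad (fun=> 1) x z.
Proof.
move=> l01 d0.
set P := spectralmx x.
have [u Pu] : exists u : 'cV[R[i]]_n, forall i, (P *m u) i 0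
    = ((kernel_denom (spectral_val x i) l)^-1)%:C * (P *m v) i 0.
  by exists (funcalc (fun t => (kernel_denom t l)^-1) x *m v) => i;
    exact: spectral_funcalc.
have [z Pz] : exists z : 'cV[R[i]]_n, forall i, (P *m z) i 0
    = (spectral_val x i / kernel_denom (spectral_val x i) l)%:C * (P *m v) i 0.
  by exists (funcalc (fun t => t / kernel_denom t l) x *m v) => i;
    exact: spectral_funcalc.
have D0 i := kernel_denom_gt0 (d0 i) l01.
exists u, z; split.
  apply: (can_inj (mulKmx (spectral_unit x))); apply/colP => i.
  rewrite -/P mulmxDr -!scalemxAr [RHS]mxE [X in _ = X + _]mxE [X in _ = _
    + X]mxE Pu Pz.
  rewrite !mulrA -!rmorphM -mulrDl -rmorphD /=.
  rewrite [X in X%:C * _](_ : _ = 1) ?mul1r //.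
  by have := D0 i; rewrite /kernel_denom => Di; field; rewrite gt_eqF.
rewrite !quadE !mulr_sumr -big_split; apply: eq_bigr => i _ /=.
rewrite -/P Pu Pz; set w := (P *m v) i 0; have Di := D0 i.
have nr (r : R) : 0 <= r -> `|r%:C| = r%:C by move=> r0; rewrite ger0_norm ?ler0c.
rewrite !normrM !exprMn nr ?invr_ge0 ?(ltW Di) // nr ?divr_ge0 ?(ltW (d0 i))
  ?(ltW Di) //.
rewrite -!rmorphXn /= mul1r !mulrA -!rmorphM -rmorphD.
congr (_%:C); move: Di; rewrite /kernel_denom => Di; field.
by rewrite gt_eqF.
Qed.

(** The decomposition optimal for [y] is admissible for [x], and in the upper bound the matrix
    enters only through [l <u, x u>], which increases with it. *)
Lemma kernel_operator_monotone (l : R) n (x y : 'M[R[i]]_n) v :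
  0 <= l <= 1 -> x \is hermsymmx -> y \is hermsymmx -> loewner_le x y ->
  (forall i, 0 < spectral_val x i) -> (forall i, 0 < spectral_val y i) ->
  quad (fun t => t / kernel_denom t l) x v <= quad (fun t
    => t / kernel_denom t l) y v.
Proof.
move=> l01 hx hy xy x0 y0; have /andP[l0 l1] := l01.
have [u [z [-> ->]]] := quad_kernel_attained v l01 y0.
apply: (le_trans (quad_kernel_le _ _ l01 x0)); rewrite !quad_cst1 lerD2r.
have l0c : 0 <= l%:C by rewrite ler0c.
apply: (ler_wpM2l l0c); rewrite (quad_id _ hx) (quad_id _ hy).
exact: (iffLR (loewner_leP hx hy) xy).
Qed.

Section RepresentedSums.
Variables (mu : {finite_measure set (measurableTypeR R) -> \bar R}) (f : R -> R).
Hypothesis rep : represents mu f.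

(** A spectral sum of [f] becomes a single integral over [l], so that inequalities between quadratic
    forms of the kernels can be integrated. *)
Lemma represented_sum n (d c : 'I_n -> R) :
  (forall i, 0 < d i) -> (forall i, 0 <= c i) ->
  let F l := \sum_i (d i / kernel_denom (d i) l) * c i in
  [/\ measurable_fun (`[0%R, 1%R] : set (measurableTypeR R)) (EFin \o F),
      forall l, 0 <= l <= 1 -> 0 <= F l &
      (\sum_i f (d i) * c i)%:E = (\int[mu]_(l in `[0%R, 1%R]) (F l)%:E)%E].
Proof.
move=> d0 c0 F.
have mF i : measurable_fun (`[0%R, 1%R] : set (measurableTypeR R))
    (fun l => d i / kernel_denom (d i) l * c i).
  apply: measurable_funM; last exact: measurable_cst.
  apply: measurable_funM; first exact: measurable_cst.
  by have [] := bmeas_kernel (d0 i).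
have F0 i l : 0 <= l <= 1 -> 0 <= d i / kernel_denom (d i) l * c i.
  by move=> l01; rewrite mulr_ge0 // divr_ge0 ?(ltW (d0 i)) // ltW //
    kernel_denom_gt0.
split.
- by apply/measurable_EFinP; exact: measurable_sum.
- by move=> l l01; apply: sumr_ge0 => i _; exact: F0.
under eq_integral do rewrite -sumEFin.
rewrite ge0_integral_sum //; last by move=> i; apply/measurable_EFinP.
rewrite -sumEFin; apply: eq_bigr => i _.
rewrite EFinM rep // muleC -ge0_integralZl //.
- by apply: eq_integral => l _; rewrite -EFinM mulrC.
- apply/measurable_EFinP; apply: measurable_funM; first exact: measurable_cst.
  by have [] := bmeas_kernel (d0 i).
- move=> l; rewrite /= in_itv /= lee_fin => l01.
  by rewrite divr_ge0 ?(ltW (d0 i)) // ltW // (kernel_denom_gt0 (d0 i) l01).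
- by rewrite lee_fin; exact: c0.
Qed.

Lemma represented_sum_le n m (d c : 'I_n -> R) (d' c' : 'I_m -> R) :
  (forall i, 0 < d i) -> (forall i, 0 < d' i) ->
  (forall i, 0 <= c i) -> (forall i, 0 <= c' i) ->
  (forall l, 0 <= l <= 1 -> \sum_i (d i / kernel_denom (d i) l) * c i
     <= \sum_i (d' i / kernel_denom (d' i) l) * c' i) ->
  \sum_i f (d i) * c i <= \sum_i f (d' i) * c' i.
Proof.
move=> d0 d'0 c0 c'0 H.
have [mF F0 IF] := represented_sum d0 c0.
have [mF' _ IF'] := represented_sum d'0 c'0.
rewrite -lee_fin IF IF'; apply: ge0_le_integral => //.
Qed.
End RepresentedSums.

Lemma represented_operator_monotone
    (mu : {finite_measure set (measurableTypeR R) -> \bar R}) f :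
  represents mu f -> operator_monotone `]0, +oo[ f.
Proof.
move=> rep n x y hx hy sx sy xy.
have x0 i : 0 < spectral_val x i.
  by have := spectral_val_in hx sx i; rewrite in_itv /= andbT.
have y0 i : 0 < spectral_val y i.
  by have := spectral_val_in hy sy i; rewrite in_itv /= andbT.
apply: (iffRL (loewner_leP (funcalc_herm f x) (funcalc_herm f y))) => v.
suff : quad f x v <= quad f y v by [].
rewrite !quad_real lecR.
apply: (represented_sum_le rep x0 y0) => [i|i|l l01];
  [exact: sqnorm_ge0|exact: sqnorm_ge0|].
have := kernel_operator_monotone v l01 hx hy xy x0 y0.
by rewrite !quad_real lecR.
Qed.

(** At [t = 1] the kernel is identically [1], so the integral is the total mass. *)
Lemma represented_at_one
    (mu : {finite_measure set (measurableTypeR R) -> \bar R}) f :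
  on_unit_interval mu -> represents mu f -> (f 1)%:E = mu [set: R].
Proof.
move=> mu01 /(_ 1 ltr01) ->.
rewrite (eq_integral (fun=> 1%E)) => [|l _]; last by rewrite mulr1 addrC subrK
  divr1.
rewrite integral_cst // mul1e -(setUv `[0%R, 1%R]%classic) measureU //.
- by rewrite [X in _ = (_ + X)%E]mu01 adde0.
- exact: measurableC.
- exact: setICr.
Qed.
End IntegralsAreMonotone.

Theorem theorem4p9 (R : realType) :
  (forall f : R -> R,
     (forall t : R, 0 < t -> 0 < f t) ->
     operator_monotone `]0, +oo[ f ->
     exists mu : {finite_measure set (measurableTypeR R) -> \bar R},
       on_unit_interval mu /\ represents mu f)
  /\
  (forall (mu : {finite_measure set (measurableTypeR R) -> \bar R})
          (f : R -> R),
     on_unit_interval mu -> represents mu f ->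
     operator_monotone `]0, +oo[ f)
  /\
  (forall (mu : {finite_measure set (measurableTypeR R) -> \bar R})
          (f : R -> R),
     on_unit_interval mu -> represents mu f ->
     (mu [set: R] = 1%E <-> f 1 = 1)).
Proof.
split=> [f fpos fmono|]; last split=> [mu f _|mu f mu01 rep].
- have [mu [mu01 rep]] := loewner_representation
    (operator_monotone_loewner fpos fmono) (divr_gt0 (fpos 1 ltr01) ltr01).
  exists mu; split=> // t t0.
  by rewrite -rep // mulrC divfK // gt_eqF.
- exact: represented_operator_monotone.
- by rewrite -(represented_at_one mu01 rep); split=> [[]//|->].
Qed.
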